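(* Let $m,n\geq 1$. (i) The natural ring homomorphism $$\mathcal O\big(\mathcal Hom^{\mathrm{c,alg}}(\mathcal L^n,\mathcal L^m)\times L^n\mathbb G_a\big)\longrightarrow\mathcal O\big(\mathcal Hom^{\mathrm{c,alg}}(\mathcal L^n,\mathcal L^m)_{\mathbb Q}\times (L^n\mathbb G_a)_{\mathbb Q}\big)$$ is injective. (ii) The ring homomorphism given by restriction $$\mathcal O\big(\mathrm{Ker}(\Upsilon)_n\times L^n\mathbb G_a\big)\longrightarrow \mathcal O\big(\mathrm{Ker}(\Upsilon)_n^{\mathrm{nil}}\times L^n\mathbb G_a\big)$$ is injective.
   Context: Rings are commutative, associative and unital. For $n\geq 1$, $\mathcal L^n(A)=A((t_1))\ldots((t_n))$ is the ring of iterated Laurent series (inductively $\mathcal L^1(A)=A((t_1))$, $\mathcal L^n(A)=\mathcal L^{n-1}(A)((t_n))$). Elements are written $f=\sum_{l\in\mathbb Z^n}a_lt^l$ with $t^l=t_1^{l_1}\cdots t_n^{l_n}$, and $\mathrm{supp}(f)=\{l: a_l\neq 0\}$. Put $\Lambda_1=\mathbb Z$, $\mathbb Z^1_\lambda=\{l\in\mathbb Z: l\geq\lambda\}$, and for $n\geq 2$ put $\Lambda_n=\mathrm{Map}(\mathbb Z,\Lambda_{n-1})\times\mathbb Z$ and $\mathbb Z^n_\lambda=\bigcup_{l_n\geq\lambda_n}\mathbb Z^{n-1}_{\lambda'(l_n)}\times\{l_n\}$ for $\lambda=(\lambda',\lambda_n)\in\Lambda_n$. A formal series lies in $\mathcal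 L^n(A)$ iff its support is contained in $\mathbb Z^n_\lambda$ for some $\lambda\in\Lambda_n$. Topology: $\mathcal L^n(A)$ is an additive topological group with a base of open neighborhoods of zero given by the $A$-submodules $U_\lambda=\{f:\mathrm{supp}(f)\cap(-\mathbb Z^n_\lambda)=\varnothing\}$, $\lambda\in\Lambda_n$. $\mathcal Hom^{\mathrm{c,alg}}(\mathcal L^n,\mathcal L^m)$ is the functor on rings sending $A$ to the set $\mathrm{Hom}^{\mathrm{c,alg}}_{A}(\mathcal L^n(A),\mathcal L^m(A))$ of all continuous homomorphisms of $A$-algebras $\mathcal L^n(A)\to\mathcal L^m(A)$; for a ring homomorphism $A\to B$, $\phi$ is sent to the unique continuous $B$-algebra homomorphism $\mathcal L^n(B)\to\mathcal L^m(B)$ sending each $t_i$ to the image of $\phi(t_i)$ in $\mathcal L^m(B)$. $L^n\mathbb G_a$ is the functor $A\mapsto\mathcal L^n(A)$ on rings. $\underline{\mathbb Z}(A)$ is the ring of locally constant functions $\mathrm{Spec}(A)\to\mathbb Z$. The lexicographical order on $\mathbb Z^n$ compares the last coordinates first: $(l_1,\ldots,l_n)\leq(l_1',\ldots,l_n')$ iff $l_n<l'_n$, or $l_n=l_n'$ and $(l_1,\ldots,l_{n-1})\leq(l'_1,\ldots,l'_{n-1})$. For $f\in\mathcal L^n(A)^*$ it is known that there is a finite decomposition $A\simeq\prod_i A_i$ and elements $l_i\in\mathbb Z^n$ such that the component $\sum_l a_{i,l}t^l\in\mathcal L^n(A_i)$ of $f$ has $a_{i,l}$ nilpotent for all $l<l_i$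 and $a_{i,l_i}$ invertible; then $\nu(f)\in\underline{\mathbb Z}(A)^n$ is the locally constant function with value $l_i$ on $\mathrm{Spec}(A_i)$, and $\nu:\mathcal L^n(A)^*\to\underline{\mathbb Z}(A)^n$ is a group homomorphism. Elements of $\underline{\mathbb Z}(A)^n$ are viewed as columns. For $\phi\in\mathrm{Hom}^{\mathrm{c,alg}}_A(\mathcal L^n(A),\mathcal L^n(A))$, $\Upsilon(\phi)$ is the $(n\times n)$-matrix over $\underline{\mathbb Z}(A)$ with columns $\nu(\phi(t_1)),\ldots,\nu(\phi(t_n))$. $\mathrm{Ker}(\Upsilon)_n$ is the subfunctor of $\mathcal Hom^{\mathrm{c,alg}}(\mathcal L^n,\mathcal L^n)$ sending $A$ to the set of $\phi$ for which $\Upsilon(\phi)$ is the identity matrix. $\mathrm{Ker}(\Upsilon)^{\mathrm{nil}}_n\subset\mathrm{Ker}(\Upsilon)_n$ is the subfunctor sending $A$ to the set of those $\phi\in\mathrm{Hom}^{\mathrm{c,alg}}_A(\mathcal L^n(A),\mathcal L^n(A))$ such that for every $1\leq i\leq n$, $\phi(t_i)=t_i+h_i$ with $h_i\in\mathcal L^n(A)$ a Laurent polynomial (finite support) all of whose coefficients are nilpotent. For a functor $F$ on rings, $F_{\mathbb Q}$ denotes its restriction to the category of $\mathbb Q$-algebras. A regular function on a functor $F$ on the category of rings (resp. $\mathbb Q$-algebras) is a morphism of functors from $F$ to the affine line $\mathbb A^1$, i.e. to the functor sending a ring (resp. $\mathbb Q$-algebra) $B$ to its underlying set $B$; $\mathcal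 O(F)$ denotes the ring of all regular functions on $F$. *)

(* Defs.v *)
From HB Require Import structures.
From mathcomp Require Import all_boot all_order all_algebra.
From mathcomp Require Import all_classical topology.
From mathcomp Require Import zify.

Set Implicit Arguments.
Unset Strict Implicit.
Unset Printing Implicit Defensive.

Import Order.TTheory GRing.Theory Num.Theory.
Local Open Scope classical_set_scope.
Local Open Scope ring_scope.

(* Rings are [comPzRingType]s, so that the zero ring is allowed. *)

Section Laurent.
Variable R : comPzRingType.

Definition lsupp_ge (f : int -> R) (N : int) := forall k : int, k < N -> f k = 0.

Definition laurent_pred : {pred int -> R} :=
  fun f => `[< exists N, lsupp_ge f N >].

Lemma lsupp_geW f M N : M <= N -> lsupp_ge f N -> lsupp_ge f M.
Proof. by move=> MN fN k kM; apply: fN; apply: lt_le_trans kM MN. Qed.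

Lemma laurent_pred_zmod : zmod_closed laurent_pred.
Proof.
split=> [|f g]; first by apply/asboolP; exists 0.
move=> /asboolP[M fM] /asboolP[N gN]; apply/asboolP; exists (Num.min M N) => k.
by rewrite lt_min => /andP[/fM fk /gN gk]; rewrite /= !fctE fk gk subr0.
Qed.

HB.instance Definition _ :=
  GRing.isZmodClosed.Build (int -> R) laurent_pred laurent_pred_zmod.

(* R((t)): the value [f k] is the coefficient of [t ^ k] *)
Record laurent := Laurent { lcoef :> int -> R; _ : lcoef \in laurent_pred }.

HB.instance Definition _ := [isSub for lcoef].
HB.instance Definition _ := [Choice of laurent by <:].
HB.instance Definition _ := [SubChoice_isSubZmodule of laurent by <:].

Lemma laurentP (f g : laurent) : f =1 g <-> f = g.
Proof. by split=> [fg|->//]; apply/val_inj/funext. Qed.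

Lemma laurent_bnd (f : laurent) : exists N, lsupp_ge f N.
Proof. exact/asboolP/(valP f). Qed.

Lemma lcoefD (f g : laurent) k : (f + g) k = f k + g k. Proof. by []. Qed.
Lemma lcoefN (f : laurent) k : (- f) k = - f k. Proof. by []. Qed.
Lemma lcoefB (f g : laurent) k : (f - g) k = f k - g k. Proof. by []. Qed.
Lemma lcoef0 k : (0 : laurent) k = 0. Proof. by []. Qed.

(* [\sum_(i \in A)] is the sum over the support, 0 if the support is infinite;
   the support is finite for Laurent series. *)
Definition lmul_fun (f g : int -> R) (k : int) : R :=
  \sum_(i \in [set: int]) f i * g (k - i).

Lemma lmul_funE f g (a b k : int) (n : nat) :
  lsupp_ge f a -> lsupp_ge g b -> k - a - b < n%:Z ->
  lmul_fun f g k = \sum_(i < n) f (a + i%:Z) * g (k - a - i%:Z).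
Proof.
move=> fa gb kn; rewrite /lmul_fun.
pose r := [seq a + i%:Z | i <- iota 0 n].
rewrite -(fsbig_widen [set` r])//; last first.
  move=> i [_ /= ir]; have [ia|ai] := ltP i a; first by rewrite fa ?mul0r.
  rewrite gb ?mulr0//; rewrite ltNge; apply/negP => bi; apply: ir.
  apply/mapP; exists (absz (i - a)%R); last by lia.
  by rewrite mem_iota; lia.
rewrite -fsbig_seq; last by rewrite map_inj_uniq ?iota_uniq// => i j; lia.
rewrite big_map -{1}[n]subn0 big_mkord; apply: eq_bigr => i _.
by congr (_ * g _); lia.
Qed.

Lemma lmul_supp f g (a b : int) :
  lsupp_ge f a -> lsupp_ge g b -> lsupp_ge (lmul_fun f g) (a + b).
Proof.
move=> fa gb k kab; rewrite (@lmul_funE _ _ a b _ 0%N)// ?big_ord0//; lia.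
Qed.

Lemma lmul_subproof (f g : laurent) : lmul_fun f g \in laurent_pred.
Proof.
have [a fa] := laurent_bnd f; have [b gb] := laurent_bnd g.
by apply/asboolP; exists (a + b); apply: lmul_supp.
Qed.

Definition lmul (f g : laurent) := Laurent (lmul_subproof f g).

Lemma lmonom_subproof (c : R) (k : int) :
  (fun i => if i == k then c else 0) \in laurent_pred.
Proof. by apply/asboolP; exists k => i ik; rewrite lt_eqF. Qed.

(* c t ^ k *)
Definition lmonom c k := Laurent (lmonom_subproof c k).

Lemma lmonom_supp c k : lsupp_ge (lmonom c k) k.
Proof. by move=> i ik /=; rewrite lt_eqF. Qed.

Let lmulC : commutative lmul.
Proof.
move=> f g; apply/laurentP => k /=.
have [a fa] := laurent_bnd f; have [b gb] := laurent_bnd g.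
pose n := (absz (k - a - b)%R).+1.
rewrite (@lmul_funE _ _ a b _ n)//; last by rewrite /n; lia.
rewrite (@lmul_funE _ _ (k - a - n%:Z + 1) a _ n)//; last first.
- by rewrite /n; lia.
- by apply: lsupp_geW gb; rewrite /n; lia.
rewrite (reindex_inj rev_ord_inj)/=; apply: eq_bigr => i _; rewrite mulrC.
have ilt := ltn_ord i; by congr (g _ * f _); lia.
Qed.

Let lmulA : associative lmul.
Proof.
move=> f g h; apply/laurentP => k /=.
have [a fa] := laurent_bnd f; have [b gb] := laurent_bnd g.
have [c hc] := laurent_bnd h.
pose n := (absz (k - a - b - c)%R).+1.
have kn : k - a - b - c < n by rewrite /n; lia.
rewrite (@lmul_funE _ _ a (b + c) _ n)//; [|exact: lmul_supp|lia].
rewrite (@lmul_funE _ _ (a + b) c _ n)//; [|exact: lmul_supp|lia].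
transitivity (\sum_(i < n) \sum_(j < n)
   f (a + i%:Z) * (g (b - i%:Z + j%:Z) * h (k - a - b - j%:Z))).
  apply: eq_bigr => i _; rewrite (@lmul_funE _ _ (b - i%:Z) c _ n)//; last first.
  - by lia.
  - by apply: lsupp_geW gb; lia.
  rewrite mulr_sumr; apply: eq_bigr => j _.
  by congr (_ * (g _ * h _)); lia.
rewrite exchange_big/=; apply: eq_bigr => j _.
rewrite (@lmul_funE _ _ a b _ n)//; last by have := ltn_ord j; lia.
rewrite mulr_suml; apply: eq_bigr => i _; rewrite mulrA.
by congr (f _ * g _ * h _); lia.
Qed.

Let lmul1 : left_id (lmonom 1 0) lmul.
Proof.
move=> f; apply/laurentP => k /=.
have [a fa] := laurent_bnd f.
rewrite (@lmul_funE _ _ 0 a _ (absz (k - a)%R).+1)//; first last.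
- by rewrite subr0; lia.
- exact: lmonom_supp.
rewrite big_ord_recl big1 => [|i _]; last by rewrite mul0r.
by rewrite addr0 mul1r !subr0.
Qed.

Let lmulDl : left_distributive lmul +%R.
Proof.
move=> f g h; apply/laurentP => k.
change (lmul_fun (f + g) h k = lmul_fun f h k + lmul_fun g h k).
have [a fa] := laurent_bnd f; have [b gb] := laurent_bnd g.
have [c hc] := laurent_bnd h.
pose d := Num.min a b.
have fd : lsupp_ge f d by apply: lsupp_geW fa; rewrite /d; lia.
have gd : lsupp_ge g d by apply: lsupp_geW gb; rewrite /d; lia.
have fgd : lsupp_ge (f + g) d by move=> i id; rewrite lcoefD fd// gd// addr0.
pose n := (absz (k - d - c)%R).+1.
rewrite !(@lmul_funE _ _ d c _ n)//; try by rewrite /n; lia.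
by rewrite -big_split; apply: eq_bigr => i _; rewrite lcoefD mulrDl.
Qed.

HB.instance Definition _ :=
  GRing.Zmodule_isComPzRing.Build laurent lmulA lmulC lmul1 lmulDl.

Lemma lcoef1 k : (1 : laurent) k = if k == 0 then 1 else 0. Proof. by []. Qed.

Lemma lcoefME (f g : laurent) a b k n :
  lsupp_ge f a -> lsupp_ge g b -> k - a - b < n%:Z ->
  (f * g) k = \sum_(i < n) f (a + i%:Z) * g (k - a - i%:Z).
Proof. exact: lmul_funE. Qed.

Definition lconst c := lmonom c 0.

Lemma lconst_zmod : zmod_morphism lconst.
Proof.
by move=> c d; apply/laurentP => k; rewrite lcoefB/=; case: eqP; rewrite ?subr0.
Qed.

Lemma lconst_monoid : monoid_morphism lconst.
Proof.
split=> // c d; apply/laurentP => k.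
rewrite (@lcoefME _ _ 0 0 _ (absz k).+1); try exact: lmonom_supp; last by lia.
rewrite big_ord_recl big1 ?addr0/= => [|i _]; last by rewrite mul0r.
by case: eqP => // _; rewrite mulr0.
Qed.

HB.instance Definition _ := GRing.isZmodMorphism.Build R laurent lconst lconst_zmod.
HB.instance Definition _ :=
  GRing.isMonoidMorphism.Build R laurent lconst lconst_monoid.

End Laurent.

Section LaurentMap.
Variables (R S : comPzRingType) (g : {rmorphism R -> S}).

Lemma lmap_subproof (f : laurent R) : (g \o f) \in @laurent_pred S.
Proof.
by have [N fN] := laurent_bnd f; apply/asboolP; exists N => k /fN /= ->; rewrite rmorph0.
Qed.

Definition lmap f := Laurent (lmap_subproof f).

Lemma lmap_zmod : zmod_morphism lmap.
Proof. by move=> f h; apply/laurentP => k; rewrite lcoefB /= -rmorphB. Qed.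

Lemma lmap_monoid : monoid_morphism lmap.
Proof.
split=> [|f h]; apply/laurentP => k.
  by rewrite /=; case: eqP; rewrite (rmorph0, rmorph1).
have [a fa] := laurent_bnd f; have [b hb] := laurent_bnd h.
have ga : lsupp_ge (lmap f) a by move=> i /fa /= ->; rewrite rmorph0.
have gb : lsupp_ge (lmap h) b by move=> i /hb /= ->; rewrite rmorph0.
pose n := (absz (k - a - b)%R).+1.
have kn : k - a - b < n%:Z by rewrite /n; lia.
transitivity (g ((f * h) k)); first by [].
rewrite (lcoefME ga gb kn) (lcoefME fa hb kn).
by rewrite rmorph_sum; apply: eq_bigr => i _; rewrite rmorphM.
Qed.

HB.instance Definition _ :=
  GRing.isZmodMorphism.Build (laurent R) (laurent S) lmap lmap_zmod.
HB.instance Definition _ :=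
  GRing.isMonoidMorphism.Build (laurent R) (laurent S) lmap lmap_monoid.

End LaurentMap.

Section Iterated.
Variable A : comPzRingType.

Fixpoint itlaurent_ring n : comPzRingType :=
  if n is n'.+1 then laurent (itlaurent_ring n') else A.

Fixpoint itconst n : {rmorphism A -> itlaurent_ring n} :=
  if n is n'.+1 return {rmorphism A -> itlaurent_ring n}
  then (@lconst (itlaurent_ring n') \o itconst n' :
         {rmorphism A -> laurent (itlaurent_ring n')})
  else idfun.

(* [t_1, ..., t_n] are indexed by ['I_n]; [t_n] is the outermost variable *)
Fixpoint tvar_ring n : 'I_n -> itlaurent_ring n :=
  if n is n'.+1 return 'I_n -> itlaurent_ring n then fun i =>
    if unlift ord_max i is Some j then lconst (tvar_ring j) else lmonom 1 1
  else fun=> 0.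

Fixpoint coef_ring n : itlaurent_ring n -> 'cV[int]_n -> A :=
  if n is n'.+1 return itlaurent_ring n -> 'cV[int]_n -> A then
    fun f l => coef_ring ((f : laurent _) (l ord_max 0)) (row' ord_max l)
  else fun f _ => f.

End Iterated.

Fixpoint itmap_ring (A B : comPzRingType) (g : {rmorphism A -> B}) n :
    {rmorphism itlaurent_ring A n -> itlaurent_ring B n} :=
  if n is n'.+1 return {rmorphism itlaurent_ring A n -> itlaurent_ring B n}
  then (lmap (itmap_ring g n') :
         {rmorphism laurent (itlaurent_ring A n') -> laurent (itlaurent_ring B n')})
  else g.

(* A((t_1))...((t_n)), as an A-algebra *)
Definition itlaurent (A : comPzRingType) n : Type := itlaurent_ring A n.

HB.instance Definition _ A n := GRing.ComPzRing.on (itlaurent A n).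

Section ItLaurent.
Variables (A : comPzRingType) (n : nat).
Implicit Types (f : itlaurent A n) (l : 'cV[int]_n).

Definition itscale (a : A) f : itlaurent A n := itconst A n a * f.

Let itscaleA a b f : itscale a (itscale b f) = itscale (a * b) f.
Proof. by rewrite /itscale rmorphM mulrA. Qed.
Let itscale1 : left_id 1 itscale.
Proof. by move=> f; rewrite /itscale rmorph1 mul1r. Qed.
Let itscaleDr : right_distributive itscale +%R.
Proof. by move=> a f h; rewrite /itscale mulrDr. Qed.
Let itscaleDl f : {morph itscale^~ f : a b / a + b}.
Proof. by move=> a b; rewrite /itscale rmorphD mulrDl. Qed.

HB.instance Definition _ := GRing.Zmodule_isLmodule.Build A (itlaurent A n)
  itscaleA itscale1 itscaleDr itscaleDl.

Definition tvar (i : 'I_n) : itlaurent A n := tvar_ring A i.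
Definition coef f l : A := coef_ring f l.
Definition supp f : set 'cV[int]_n := [set l | coef f l != 0].

End ItLaurent.

Definition itmap (A B : comPzRingType) (g : {rmorphism A -> B}) n :
  {rmorphism itlaurent A n -> itlaurent B n} := itmap_ring g n.

Lemma coefB A n (f g : itlaurent A n) l : coef (f - g) l = coef f l - coef g l.
Proof.
rewrite /coef; elim: n f g l => [//|n IHn] f g l /=.
exact: (IHn (lcoef f _) (lcoef g _)).
Qed.

Lemma coef0 A n l : coef (0 : itlaurent A n) l = 0.
Proof. by rewrite -(subrr 0) coefB subrr. Qed.

Lemma coefN A n (f : itlaurent A n) l : coef (- f) l = - coef f l.
Proof. by rewrite -[- f]add0r coefB coef0 add0r. Qed.

Lemma coefD A n (f g : itlaurent A n) l : coef (f + g) l = coef f l + coef g l.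
Proof. by rewrite -{1}[g]opprK coefB coefN opprK. Qed.

Lemma coef_itmap (A B : comPzRingType) (g : {rmorphism A -> B}) n (f : itlaurent A n) l :
  coef (itmap g n f) l = g (coef f l).
Proof.
rewrite /coef /itmap; elim: n f l => [//|n IHn] f l /=; exact: (IHn (lcoef f _)).
Qed.

Lemma coef_ring0 A n l : coef_ring (0 : itlaurent_ring A n) l = 0.
Proof. exact: coef0. Qed.

Lemma coef_ring1 A n l : coef_ring (1 : itlaurent_ring A n) l = (l == 0)%:R.
Proof.
elim: n l => [|n IHn] l /=; first by rewrite (flatmx0 l) eqxx.
case: eqP => l0.
  rewrite IHn; congr (_%:R); congr nat_of_bool.
  apply/eqP/eqP => [lr|->]; last by apply/colP => i; rewrite !mxE.
  apply/colP => i; rewrite mxE; case: (unliftP ord_max i) => [j|] ->//.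
  by move/colP/(_ j): lr; rewrite !mxE.
rewrite coef_ring0; case: eqP => // l00; case: l0; by rewrite l00 mxE.
Qed.

Lemma coef_tvar A n (i : 'I_n) l : coef (tvar A i) l = (l == delta_mx i 0)%:R.
Proof.
rewrite /coef /tvar; elim: n i l => [[]//|n IHn] i l /=.
case: (unliftP ord_max i) => [j|] -> /=.
  case: eqP => l0.
    rewrite IHn; congr (_%:R); congr nat_of_bool.
    apply/eqP/eqP => [lr|->]; last first.
      by apply/colP => k; rewrite !mxE (inj_eq lift_inj).
    apply/colP => k; case: (unliftP ord_max k) => [k'|] ->.
      by move/colP/(_ k'): lr; rewrite !mxE (inj_eq lift_inj).
    by rewrite l0 mxE eq_liftF.
  rewrite coef_ring0; case: eqP => // l00; case: l0.
  by rewrite l00 mxE eq_liftF.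
case: eqP => l1.
  rewrite coef_ring1; congr (_%:R); congr nat_of_bool.
  apply/eqP/eqP => [lr|->]; last first.
    by apply/colP => k; rewrite !mxE eq_sym eq_liftF.
  apply/colP => k; case: (unliftP ord_max k) => [k'|] ->.
    by move/colP/(_ k'): lr; rewrite !mxE eq_sym eq_liftF.
  by rewrite l1 mxE eqxx.
rewrite coef_ring0; case: eqP => // l00; case: l1.
by rewrite l00 mxE eqxx.
Qed.

(* Lambda_n and Z^n_lambda; starting the recursion at [n = 0] (with Z^0_lambda
   a point) gives Lambda_1 = (int -> unit) * int, in bijection with int. *)
Fixpoint bounds n : Type :=
  if n is n'.+1 then ((int -> bounds n') * int)%type else unit.

Fixpoint Zge n : bounds n -> set 'cV[int]_n :=
  if n is n'.+1 return bounds n -> set 'cV[int]_n then fun lam =>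
    [set l : 'cV[int]_n'.+1 | lam.2 <= l ord_max 0 /\ Zge (lam.1 (l ord_max 0)) (row' ord_max l)]
  else fun=> setT.

Definition Uzero A n (lam : bounds n) : set (itlaurent A n) :=
  [set f | supp f `&` [set - l | l in Zge lam] = set0].

Lemma UzeroE A n (lam : bounds n) (f : itlaurent A n) :
  Uzero lam f <-> forall l, Zge lam l -> coef f (- l) = 0.
Proof.
split=> [Uf l Zl|Uf].
  apply/eqP/negP => /negP fl.
  by move/seteqP: Uf => [/(_ (- l)) + _]; apply; split=> //; exists l.
by apply/seteqP; split=> // x [fx [l Zl lx]]; move: fx; rewrite -lx /supp/= Uf// eqxx.
Qed.

Lemma Uzero0 A n (lam : bounds n) : @Uzero A n lam 0.
Proof. by apply/UzeroE => l _; rewrite coef0. Qed.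

Lemma UzeroD A n (lam : bounds n) (f g : itlaurent A n) :
  Uzero lam f -> Uzero lam g -> Uzero lam (f + g).
Proof.
by move=> /UzeroE Uf /UzeroE Ug; apply/UzeroE => l Zl; rewrite coefD Uf// Ug// addr0.
Qed.

Lemma Zge_directed n (lam mu : bounds n) :
  exists nu : bounds n, Zge lam `|` Zge mu `<=` Zge nu.
Proof.
elim: n lam mu => [|n IHn]; first by exists tt.
move=> [lam lam0] [mu mu0].
have [nu nuP] := choice (fun k => IHn (lam k) (mu k)).
exists (nu, Num.min lam0 mu0) => l /= [[l0 Zl]|[l0 Zl]]; split.
- by rewrite ge_min l0.
- by apply: nuP; left.
- by rewrite ge_min l0 orbT.
- by apply: nuP; right.
Qed.

Fixpoint bounds0 n : bounds n :=
  if n is n'.+1 return bounds n then (fun=> bounds0 n', 0) else tt.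

Section Topology.
Variables (A : comPzRingType) (n : nat).
Local Notation L := (itlaurent A n).

HB.instance Definition _ := hasNbhs.Build L
  (fun f => [set W | exists lam : bounds n, [set f + h | h in Uzero lam] `<=` W]).

Let nbhs_filter (f : L) : ProperFilter (nbhs f).
Proof.
apply: Build_ProperFilter_ex => [W [lam sW]|].
  by exists f; apply: sW; exists 0; [exact: Uzero0|rewrite addr0].
split=> [|V W [lam sV] [mu sW]|V W VW [lam sV]].
- by exists (bounds0 n).
- have [nu nuP] := Zge_directed lam mu.
  exists nu => _ [h /UzeroE Uh <-]; split.
    by apply: sV; exists h => //; apply/UzeroE => l Zl; apply/Uh/nuP; left.
  by apply: sW; exists h => //; apply/UzeroE => l Zl; apply/Uh/nuP; right.
- by exists lam => h /sV /VW.
Qed.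

Let nbhs_singleton (f : L) (W : set L) : nbhs f W -> W f.
Proof.
by move=> [lam sW]; apply: sW; exists 0; [exact: Uzero0|rewrite addr0].
Qed.

Let nbhs_nbhs (f : L) (W : set L) : nbhs f W -> nbhs f (nbhs^~ W).
Proof.
move=> [lam sW]; exists lam => _ [h Uh <-]; exists lam => _ [k Uk <-].
by apply: sW; exists (h + k); [exact: UzeroD|rewrite addrA].
Qed.

HB.instance Definition _ :=
  Nbhs_isNbhsTopological.Build L nbhs_filter nbhs_singleton nbhs_nbhs.

End Topology.

(* continuous homomorphisms of A-algebras *)
Record calgHom (A : comPzRingType) (n m : nat) := CAlgHom {
  calg_fun :> {rmorphism itlaurent A n -> itlaurent A m};
  calg_scalable : scalable calg_fun;
  calg_continuous : continuous calg_fun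
}.

Section Spectrum.
Variable A : comPzRingType.

Record prime_ideal (p : set A) : Prop := PrimeIdeal {
  prime_ideal0 : p 0;
  prime_idealD : forall a b, p a -> p b -> p (a + b);
  prime_idealM : forall a b, p b -> p (a * b);
  prime_ideal1 : ~ p 1;
  prime_ideal_prime : forall a b, p (a * b) -> p a \/ p b
}.

Record spec := Spec { spec_ideal :> A -> Prop; specP : prime_ideal spec_ideal }.

Lemma spec_ext (p q : spec) : (forall a, p a <-> q a) -> p = q.
Proof.
case: p q => [p pP] [q qP] /= pq.
have e : p = q by apply/funext => a; apply/propext.
by move: qP; rewrite -e => qP; rewrite (Prop_irrelevance pP qP).
Qed.

HB.instance Definition _ := gen_eqMixin spec.
HB.instance Definition _ := gen_choiceMixin spec.

(* the complement of V(E) *)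
Definition zariski_open : set_system spec :=
  [set W | exists E : set A, W = [set p : spec | ~ (E `<=` spec_ideal p)]].

Let zariskiT : zariski_open setT.
Proof.
exists setT; apply/seteqP; split=> // p _ /= /(_ 1 I); exact: prime_ideal1 (specP p).
Qed.

Let zariskiI : setI_closed zariski_open.
Proof.
move=> _ _ [E ->] [F ->]; exists [set a * b | a in E & b in F].
apply/seteqP; split=> p /=.
  move=> [Ep Fp] EFp; apply: Ep => a Ea; have [//|pa] := pselect (p a).
  exfalso; apply: Fp => b Fb.
  have pab : p (a * b) by apply: EFp; exists a => //; exists b.
  by have [] := prime_ideal_prime (specP p) pab.
move=> EFp; split=> sp; apply: EFp => _ [a Ea [b Fb <-]].
  by rewrite mulrC; apply: (prime_idealM (specP p)); apply: sp.
by apply: (prime_idealM (specP p)); apply: sp.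
Qed.

Let zariski_bigU (I : Type) (W : I -> set spec) :
  (forall i, zariski_open (W i)) -> zariski_open (\bigcup_i W i).
Proof.
move=> /choice[E WE]; exists (\bigcup_i E i); apply/seteqP; split=> p /=.
  move=> [i _]; rewrite WE /= => Eip Ep; apply: Eip => a Ea.
  by apply: Ep; exists i.
move=> Ep; apply: contrapT => Wp; apply: Ep => a [i _ Eia].
apply: contrapT => pa; apply: Wp; exists i => //; rewrite WE => Eip.
exact/pa/Eip.
Qed.

HB.instance Definition _ :=
  isOpenTopological.Build spec zariskiT zariskiI zariski_bigU.

Definition locally_constant : {pred spec -> int} :=
  fun v => `[< forall p : spec, \forall q \near p, v q = v p >].

Lemma locally_constant_subring : subring_closed locally_constant.
Proof.
split=> [|v w /asboolP vP /asboolP wP|v w /asboolP vP /asboolP wP];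
  apply/asboolP => p; first exact: filterE.
- by near=> q; rewrite !fctE (near (vP p) q)// (near (wP p) q).
- by near=> q; rewrite !fctE (near (vP p) q)// (near (wP p) q).
Unshelve. all: by end_near. Qed.

HB.instance Definition _ :=
  GRing.isSubringClosed.Build (spec -> int) locally_constant locally_constant_subring.

(* the ring of locally constant functions Spec A -> Z *)
Record underZ := UnderZ { underZ_fun :> spec -> int; _ : underZ_fun \in locally_constant }.

HB.instance Definition _ := [isSub for underZ_fun].
HB.instance Definition _ := [Choice of underZ by <:].
HB.instance Definition _ :=
  GRing.SubChoice_isSubComPzRing.Build _ _ underZ locally_constant_subring.

End Spectrum.

Section SpecMap.
Variables (A B : comPzRingType) (g : {rmorphism A -> B}).

Lemma spec_map_subproof (q : spec B) : prime_ideal (fun a => q (g a)).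
Proof.
have qP := specP q; split=> /=.
- by rewrite rmorph0; apply: prime_ideal0.
- by move=> a b; rewrite rmorphD; apply: prime_idealD.
- by move=> a b; rewrite rmorphM; apply: prime_idealM.
- by rewrite rmorph1; apply: prime_ideal1.
- by move=> a b; rewrite rmorphM; apply: prime_ideal_prime.
Qed.

Definition spec_map q : spec A := Spec (spec_map_subproof q).

End SpecMap.

Fixpoint lexle n : rel 'cV[int]_n :=
  if n is n'.+1 return rel 'cV[int]_n then fun l l' : 'cV[int]_n'.+1 =>
    (l ord_max 0 < l' ord_max 0) ||
    ((l ord_max 0 == l' ord_max 0) && lexle (row' ord_max l) (row' ord_max l'))
  else fun _ _ => true.

Definition lexlt n (l l' : 'cV[int]_n) := lexle l l' && (l != l').

Definition nilpotent (A : comPzRingType) (a : A) := exists k, a ^+ k = 0.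

Definition invertible (A : comPzRingType) (a : A) := exists b, a * b = 1.

(* the [g i] induce an isomorphism from A to the product of the [B i] *)
Definition is_product (A : comPzRingType) k (B : 'I_k -> comPzRingType)
    (g : forall i, {rmorphism A -> B i}) :=
  forall y : (forall i, B i), exists! x : A, forall i, g i x = y i.

(* [v] has the constant value [l i] on the image of Spec (B i) in Spec A *)
Definition has_valuation A n (f : itlaurent A n) (v : 'cV[underZ A]_n) :=
  exists k (B : 'I_k -> comPzRingType) (g : forall i, {rmorphism A -> B i})
      (l : 'I_k -> 'cV[int]_n),
    is_product g /\ forall i,
    [/\ forall l', lexlt l' (l i) -> nilpotent (coef (itmap (g i) n f) l'),
        invertible (coef (itmap (g i) n f) (l i)) &
        forall q : spec (B i),
          map_mx (fun z : underZ A => z (spec_map (g i) q)) v = l i].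

(* Every invertible f has a valuation, unique by [has_valuation_uniq]; the value
   0 for the other f is a dummy. *)
Definition nu A n (f : itlaurent A n) : 'cV[underZ A]_n :=
  xget 0 (has_valuation f).

Definition Upsilon A n (phi : calgHom A n n) : 'M[underZ A]_n :=
  \matrix_(i, j) nu (phi (tvar A j)) i 0.

Definition KerUpsilon A n (phi : calgHom A n n) : Prop := Upsilon phi = 1%:M.

Definition KerUpsilon_nil A n (phi : calgHom A n n) : Prop :=
  forall i, exists h : itlaurent A n,
    [/\ phi (tvar A i) = tvar A i + h, finite_set (supp h) &
        forall l, nilpotent (coef h l)].

Lemma lexle_total n : total (@lexle n).
Proof.
elim: n => [//|n IHn] l l' /=; rewrite [l' _ _ == _]eq_sym.
by case: ltgtP => //= _; apply: IHn.
Qed.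

Lemma is_product_spec (A : comPzRingType) k (B : 'I_k -> comPzRingType)
    (g : forall i, {rmorphism A -> B i}) (p : spec A) :
  is_product g -> exists i (q : spec (B i)), p = spec_map (g i) q.
Proof.
move=> gP; have pP := specP p.
have inj x x' : (forall i, g i x = g i x') -> x = x'.
  move=> xx'; have [z [_ zu]] := gP (fun i => g i x').
  by rewrite -(zu x)// -(zu x').
pose d i j : B j := if i == j then 1 else 0.
have /choice[e eP] : forall i, exists x, forall j, g j x = d i j.
  by move=> i; have [x [? _]] := gP (d i); exists x.
have surj i b : exists x, g i x = b.
  have [x [xP _]] := gP (fun j => 
    match eqVneq i j with
    | EqNotNeq ij => ecast j (B j) ij b
    | NeqNotEq _ => 0
    end).
  exists x; rewrite xP; case: eqVneq => [ii|]; last by rewrite eqxx.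
  by rewrite (eq_axiomK ii).
have [i pi] : exists i, ~ p (e i).
  apply: contrapT => /forallNP pe; apply: (prime_ideal1 pP).
  have -> : 1 = \sum_i e i.
    apply: inj => j; rewrite rmorph1 rmorph_sum (bigD1 j)//= big1 ?addr0.
      by rewrite eP /d eqxx.
    by move=> i /negPf ij; rewrite eP /d ij.
  apply: (big_ind (fun x => p x)); first exact: prime_ideal0.
    exact: prime_idealD.
  by move=> i _; apply: contrapT (pe i).
have resp a a' : g i a = g i a' -> p a -> p a'.
  move=> aa' pa; case: (prime_ideal_prime pP (a := e i) (b := a')) => //.
  rewrite (_ : e i * a' = e i * a); first exact: prime_idealM.
  apply: inj => j; rewrite !rmorphM eP /d; case: eqP => [<-|_].
    by rewrite aa'.
  by rewrite !mul0r.
have qP : prime_ideal [set b | forall a, g i a = b -> p a].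
  split=> /=.
  - by move=> a ga; apply: (resp 0); [rewrite rmorph0|exact: prime_ideal0].
  - move=> b c pb pc a ga; have [b' gb] := surj i b; have [c' gc] := surj i c.
    apply: (resp (b' + c')); first by rewrite rmorphD gb gc.
    by apply: prime_idealD => //; [apply: pb|apply: pc].
  - move=> b c pc a ga; have [b' gb] := surj i b; have [c' gc] := surj i c.
    apply: (resp (b' * c')); first by rewrite rmorphM gb gc.
    by apply: prime_idealM => //; apply: pc.
  - by move=> /(_ 1); rewrite rmorph1 => /(_ erefl); apply: prime_ideal1.
  - move=> b c pbc; have [b' gb] := surj i b; have [c' gc] := surj i c.
    have := pbc (b' * c'); rewrite rmorphM gb gc => /(_ erefl).
    by case/(prime_ideal_prime pP) => [pb|pc]; [left|right] => a ga;
      [apply: resp pb|apply: resp pc]; rewrite ga.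
exists i, (Spec qP); apply: spec_ext => a; split=> /=.
  by move=> pa a' aa'; apply: resp pa.
by apply.
Qed.

Lemma invertible_notin (A B : comPzRingType) (g : {rmorphism A -> B}) (q : spec B) (a : A) :
  invertible (g a) -> ~ spec_map g q a.
Proof.
move=> [b ab] /= qa; have qP := specP q; apply: (prime_ideal1 qP).
by rewrite -ab mulrC; apply: prime_idealM.
Qed.

Lemma nilpotent_in (A B : comPzRingType) (g : {rmorphism A -> B}) (q : spec B) (a : A) :
  nilpotent (g a) -> spec_map g q a.
Proof.
move=> [k ak] /=; have qP := specP q.
have : q (g a ^+ k) by rewrite ak; apply: prime_ideal0.
elim: k {ak} => [|k IHk]; first by rewrite expr0 => /(prime_ideal1 qP).
by rewrite exprS => /(prime_ideal_prime qP)[].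
Qed.

Lemma has_valuation_spec A n (f : itlaurent A n) v (p : spec A) :
  has_valuation f v ->
  let l := map_mx (fun z : underZ A => z p) v in
  ~ p (coef f l) /\ (forall l', lexlt l' l -> p (coef f l')).
Proof.
move=> [k [B [g [l [gP vP]]]]] /=.
have [i [q ->]] := is_product_spec p gP.
have [nilf invf ->] := vP i; split.
  by apply: invertible_notin; rewrite -coef_itmap.
by move=> l' /nilf nill'; apply: nilpotent_in; rewrite -coef_itmap.
Qed.

Lemma has_valuation_uniq A n (f : itlaurent A n) v w :
  has_valuation f v -> has_valuation f w -> v = w.
Proof.
move=> fv fw.
have vw p : map_mx (fun z : underZ A => z p) v = map_mx (fun z : underZ A => z p) w.
  have /= [nv ltv] := has_valuation_spec p fv.
  have /= [nw ltw] := has_valuation_spec p fw.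
  move: nv ltv nw ltw; set l := map_mx _ v; set l' := map_mx _ w => nv ltv nw ltw.
  apply/eqP/negP => /negP ll'; have /orP[lel|lel] := lexle_total l l'.
    by apply: nv; apply: ltw; rewrite /lexlt lel.
  by apply: nw; apply: ltv; rewrite /lexlt lel eq_sym.
apply/colP => i; apply/val_inj/funext => p /=.
by have /colP/(_ i) := vw p; rewrite !mxE.
Qed.

Lemma nuE A n (f : itlaurent A n) v : has_valuation f v -> nu f = v.
Proof. by move=> fv; apply: xget_unique => // w /(has_valuation_uniq fv). Qed.

Lemma invertible1D (A : comPzRingType) (a : A) : nilpotent a -> invertible (1 + a).
Proof.
move=> [k ak]; exists (\sum_(i < k) (- a) ^+ i).
have := subrX1 (- a) k; rewrite exprNn ak mulr0 sub0r => /(congr1 -%R).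
by rewrite opprK -mulNr opprB opprK => <-.
Qed.

Lemma KerUpsilon_nil_sub A n (phi : calgHom A n n) :
  KerUpsilon_nil phi -> KerUpsilon phi.
Proof.
move=> nilphi; rewrite /KerUpsilon; apply/matrixP => i j; rewrite mxE.
have [h [-> _ hnil]] := nilphi j.
rewrite (@nuE _ _ _ (delta_mx j 0)); first by rewrite !mxE eqxx andbT.
exists 1%N, (fun=> A), (fun=> idfun), (fun=> delta_mx j 0); split.
  move=> y; exists (y 0); split=> [i'|x /(_ 0)/= <-]//; by rewrite (ord1 i').
move=> _; split.
- move=> l' /andP[_ /negPf l'j]; rewrite coef_itmap coefD coef_tvar l'j.
  by rewrite add0r; apply: hnil.
- by rewrite coef_itmap coefD coef_tvar eqxx; apply: invertible1D.
- by move=> q; apply/colP => k; rewrite !mxE; case: eqP.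
Qed.

Record ring_category := RingCategory {
  obj : Type;
  ring_of : obj -> comPzRingType;
  arrow : obj -> obj -> Type;
  arrow_map : forall X Y, arrow X Y -> {rmorphism ring_of X -> ring_of Y}
}.

Definition rings : ring_category :=
  @RingCategory comPzRingType id (fun A B => {rmorphism A -> B}) (fun _ _ g => g).

Record Qalgebra := QAlgebra {
  Qring :> comPzRingType;
  Qstruct : {rmorphism rat -> Qring}
}.

Record Qhom (A B : Qalgebra) := QHom {
  Qhom_fun :> {rmorphism A -> B};
  Qhom_struct : forall q, Qhom_fun (Qstruct A q) = Qstruct B q
}.

Definition Qalgebras : ring_category :=
  @RingCategory Qalgebra Qring Qhom Qhom_fun.

(* Functors to sets. The map F(g) is given by its graph: [fgraph g x y] means
   y = F(g)(x). This allows to state "the unique continuous homomorphism such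
   that" without having constructed it. *)
Record functor (C : ring_category) := Functor {
  fobj :> obj C -> Type;
  fgraph : forall X Y, arrow X Y -> fobj X -> fobj Y -> Prop
}.

Definition prod_functor C (F G : functor C) : functor C :=
  @Functor C (fun X => F X * G X)%type
    (fun X Y g x y => fgraph g x.1 y.1 /\ fgraph g x.2 y.2).

Definition subfunctor C (F : functor C) (P : forall X, F X -> Prop) : functor C :=
  @Functor C (fun X => {x : F X | P X x})
    (fun X Y g x y => fgraph g (sval x) (sval y)).

Definition restrict_Q (F : functor rings) : functor Qalgebras :=
  @Functor Qalgebras (fun A => F (Qring A))
    (fun A B g x y => @fgraph rings F _ _ (Qhom_fun g) x y).

Record functor_map C (F G : functor C) := FunctorMap {
  fm_fun :> forall X, F X -> G X;
  fm_natural : forall X Y (g : arrow X Y) x y,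
    fgraph g x y -> fgraph g (fm_fun x) (fm_fun y)
}.

Definition id_map C (F : functor C) : functor_map F F :=
  @FunctorMap C F F (fun _ x => x) (fun _ _ _ _ _ xy => xy).

Definition incl_map C (F : functor C) (P Q : forall X, F X -> Prop)
    (PQ : forall X x, P X x -> Q X x) :
    functor_map (subfunctor P) (subfunctor Q) :=
  @FunctorMap C (subfunctor P) (subfunctor Q)
    (fun X x => exist (Q X) (sval x) (PQ X (sval x) (proj2_sig x)))
    (fun _ _ _ _ _ xy => xy).

Lemma prod_map_natural C (F G F' G' : functor C) (u : functor_map F F')
    (v : functor_map G G') X Y (g : arrow X Y) (x : prod_functor F G X)
    (y : prod_functor F G Y) :
  fgraph g x y ->
  @fgraph C (prod_functor F' G') _ _ g (u _ x.1, v _ x.2) (u _ y.1, v _ y.2).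
Proof. by move=> [x1 x2]; split; apply: fm_natural. Qed.

Definition prod_map C (F G F' G' : functor C) (u : functor_map F F')
    (v : functor_map G G') :
    functor_map (prod_functor F G) (prod_functor F' G') :=
  @FunctorMap C (prod_functor F G) (prod_functor F' G')
    (fun X x => (u X x.1, v X x.2)) (prod_map_natural u v).

(* regular functions, i.e. morphisms from F to the affine line *)
Record regular_fun C (F : functor C) := Regular {
  reg_fun :> forall X, F X -> ring_of X;
  reg_natural : forall X Y (g : arrow X Y) x y,
    fgraph g x y -> reg_fun y = arrow_map g (reg_fun x)
}.

Lemma regularP C (F : functor C) (r s : regular_fun F) :
  (forall X (x : F X), r X x = s X x) -> r = s.
Proof.
case: r s => [r rP] [s sP] /= rs.
have e : r = s.
  by apply: functional_extensionality_dep => X; apply/funext => x.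
by move: sP; rewrite -e => sP; rewrite (Prop_irrelevance rP sP).
Qed.

Section RegularRing.
Variables (C : ring_category) (F : functor C).
Implicit Types r s : regular_fun F.

Program Definition reg0 := @Regular C F (fun _ _ => 0) _.
Next Obligation. by move=> *; rewrite rmorph0. Qed.
Program Definition reg1 := @Regular C F (fun _ _ => 1) _.
Next Obligation. by move=> *; rewrite rmorph1. Qed.
Program Definition regN r := @Regular C F (fun X x => - r X x) _.
Next Obligation. by move=> r X Y g x y xy /=; rewrite (reg_natural r xy) rmorphN. Qed.
Program Definition regD r s := @Regular C F (fun X x => r X x + s X x) _.
Next Obligation.
by move=> r s X Y g x y xy /=; rewrite (reg_natural r xy) (reg_natural s xy) rmorphD.
Qed.
Program Definition regM r s := @Regular C F (fun X x => r X x * s X x) _.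
Next Obligation.
by move=> r s X Y g x y xy /=; rewrite (reg_natural r xy) (reg_natural s xy) rmorphM.
Qed.

Lemma regular_ring_theory :
  Ring_theory.ring_theory reg0 reg1 regD regM (fun r s => regD r (regN s)) regN eq.
Proof.
split=> [r|r s|r s t|r|r s|r s t|r s t|r s|r]; apply: regularP => X x /=.
- exact: add0r.
- exact: addrC.
- exact: addrA.
- exact: mul1r.
- exact: mulrC.
- exact: mulrA.
- exact: mulrDl.
- by [].
- exact: subrr.
Qed.

End RegularRing.

Definition regular_ring_hom C D (F : functor C) (G : functor D)
    (u : regular_fun F -> regular_fun G) :=
  [/\ u (reg1 F) = reg1 G, forall r s, u (regD r s) = regD (u r) (u s) &
      forall r s, u (regM r s) = regM (u r) (u s)].

Definition regular_Q (F : functor rings) (r : regular_fun F) :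
    regular_fun (restrict_Q F) :=
  @Regular Qalgebras (restrict_Q F) (fun A x => r (Qring A) x)
    (fun A B g x y => @reg_natural rings F r A B g x y).

Definition pullback C (F G : functor C) (u : functor_map F G) (r : regular_fun G) :
    regular_fun F :=
  @Regular C F (fun X x => r X (u X x))
    (fun X Y g x y xy => reg_natural r (fm_natural u xy)).

Lemma regular_Q_ring_hom (F : functor rings) : regular_ring_hom (@regular_Q F).
Proof. by split=> *; apply: regularP. Qed.

Lemma pullback_ring_hom C (F G : functor C) (u : functor_map F G) :
  regular_ring_hom (pullback u).
Proof. by split=> *; apply: regularP. Qed.

Definition LGa n : functor rings :=
  @Functor rings (fun A => itlaurent A n) (fun A B g f f' => f' = itmap g n f).

(* [psi] is the base change of [phi]: the unique continuous homomorphism of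
   B-algebras that sends t_i to the image of phi(t_i) *)
Definition Homcalg n m : functor rings :=
  @Functor rings (fun A => calgHom A n m)
    (fun A B g phi psi => forall i, psi (tvar B i) = itmap g m (phi (tvar A i))).

Definition KerUpsilon_functor n : functor rings :=
  @subfunctor rings (Homcalg n n) (fun A phi => KerUpsilon phi).

Definition KerUpsilon_nil_functor n : functor rings :=
  @subfunctor rings (Homcalg n n) (fun A phi => KerUpsilon_nil phi).

Definition KerUpsilon_nil_incl n :
    functor_map (KerUpsilon_nil_functor n) (KerUpsilon_functor n) :=
  @incl_map rings (Homcalg n n) _ _ (fun A phi => @KerUpsilon_nil_sub A n phi).

(* Main.v *)
(** A continuous homomorphism phi is the same as a family of units u_i = phi(t_i) such that
u^l tends to 0 as l leaves the sets -Z^n_lambda. If A is connected, a unit u of L^m(A) is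
the product of a monomial t^nu and of a unit whose powers have their supports in a common
bounded set; so convergence only depends on the exponents nu_i, and it is enough to
prescribe the leading exponents of the u_i.

Let r and s be regular functions to be compared at (phi, f). Every a <> 0 in A remains
nonzero in A / I for I maximal among the ideals that do not contain a, and A / I is
connected, so let A be connected. Now deform u_i to t^nu_i + mu (u_i - t^nu_i), over the
localization D of A[mu] at the polynomials with value 1 at 0 and invertible value at 1. The
original point is the fibre at mu = 1, and D embeds into the product of the A[mu]/(mu^N),
where mu is nilpotent; so it is enough to compare r and s at points t^nu_i + mu h_i over
A[mu]/(mu^N).
For (i), these lift to B[mu]/(mu^N) with B a polynomial ring over Z, which embeds into a
Q-algebra. For (ii), a second deformation multiplies the coefficient of t^l in h_i by
sigma^|l|; modulo sigma^M only finitely many coefficients remain. *)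

From HB Require Import structures.
From mathcomp Require Import all_boot all_order all_algebra.
From mathcomp Require Import finmap generic_quotient.
From mathcomp.multinomials Require monalg.
From mathcomp Require Import all_classical topology.
From mathcomp Require Import zify ring.
Require Import Defs.

Set Implicit Arguments.
Unset Strict Implicit.
Unset Printing Implicit Defensive.

Import Order.TTheory GRing.Theory Num.Theory.
Local Open Scope classical_set_scope.
Local Open Scope ring_scope.
Local Open Scope quotient_scope.

(** * Bounded sets of exponents *)

(** Regular functions can only be compared along base change of points, so each ring of the argument
    must carry a point with the required values on the variables. A fixed additive map [kappa] of
    exponents ensures this: its properness is inherited from the given homomorphism and concerns
    exponents alone, so it persists over every ring, and [hom_of_leads] realizes every tuple with
    these leading exponents. Connectedness is what turns locally constant exponents into one such
    map. The denominators are dictated by the deformation: a leading coefficient c becomes 1 + mu (c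
    - 1), which is 1 at mu = 0 and c at mu = 1. The obstacle is that a series with nilpotent
    coefficients need not be nilpotent, and its powers need not have supports in a common bounded
    set. So the part of a unit below its leading exponent must be shown nilpotent in the series ring
    itself; this is tested modulo each prime of the coefficient ring, where lowest terms make
    sense. *)

Definition ccons n (l : 'cV[int]_n) (j : int) : 'cV[int]_n.+1 :=
  \col_i if unlift ord_max i is Some k then l k 0 else j.

Lemma ccons_last n (l : 'cV[int]_n) j : ccons l j ord_max 0 = j.
Proof. by rewrite mxE unlift_none. Qed.

Lemma ccons_row n (l : 'cV[int]_n) j : row' ord_max (ccons l j) = l.
Proof. by apply/colP => i; rewrite !mxE liftK. Qed.

Lemma cconsK n (l : 'cV[int]_n.+1) : ccons (row' ord_max l) (l ord_max 0) = l.
Proof.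
by apply/colP => i; rewrite !mxE; case: unliftP => [k|] ->; rewrite ?mxE.
Qed.

Lemma cconsD n (l l' : 'cV[int]_n) j j' :
  ccons (l + l') (j + j') = ccons l j + ccons l' j'.
Proof. by apply/colP => i; rewrite !mxE; case: unliftP => [k|] _; rewrite ?mxE. Qed.

Lemma cconsN n (l : 'cV[int]_n) j : ccons (- l) (- j) = - ccons l j.
Proof. by apply/colP => i; rewrite !mxE; case: unliftP => [k|] _; rewrite ?mxE. Qed.

Lemma cconsB n (l l' : 'cV[int]_n) j j' :
  ccons (l - l') (j - j') = ccons l j - ccons l' j'.
Proof. by rewrite cconsD cconsN. Qed.

Lemma ccons_eq n (l l' : 'cV[int]_n) j j' :
  ccons l j = ccons l' j' -> l = l' /\ j = j'.
Proof.
by move=> e; split; [rewrite -(ccons_row l j) e ccons_row|rewrite -(ccons_last l j) e ccons_last].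
Qed.

(** These are the possible supports of iterated Laurent series. Subsets of the [Zge lam] are taken,
    so that the class is closed under subsets, finite unions and sums. *)
Definition bnd n (E : set 'cV[int]_n) := exists lam, E `<=` Zge lam.

Definition slice n (E : set 'cV[int]_n.+1) j : set 'cV[int]_n :=
  [set l | E (ccons l j)].

Lemma bndS n (E : set 'cV[int]_n.+1) : bnd E <->
  (exists N, forall l, E l -> N <= l ord_max 0) /\ forall j, bnd (slice E j).
Proof.
split=> [[lam El]|[[N EN] /choice[lam Elam]]].
  split=> [|j]; first by exists lam.2 => l /El[].
  by exists (lam.1 j) => l /El[]; rewrite ccons_last ccons_row.
exists (lam, N) => l El; split=> /=; first exact: EN.
by apply: Elam; rewrite /slice /= cconsK.
Qed.

Lemma bndW n (E F : set 'cV[int]_n) : E `<=` F -> bnd F -> bnd E.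
Proof. by move=> EF [lam Fl]; exists lam; apply: subset_trans EF Fl. Qed.

Lemma bndU n (E F : set 'cV[int]_n) : bnd E -> bnd F -> bnd (E `|` F).
Proof.
move=> [lam El] [mu Fm]; have [nu nuP] := Zge_directed lam mu; exists nu.
by apply: subset_trans nuP; apply: setUSS.
Qed.

Lemma bnd0 n : @bnd n set0.
Proof. by exists (bounds0 n). Qed.

Lemma bnd1 n (l : 'cV[int]_n) : bnd [set l].
Proof.
elim: n l => [|n IHn] l; first by exists tt.
apply/bndS; split=> [|j]; first by exists (l ord_max 0) => _ ->.
apply: bndW (IHn (row' ord_max l)) => l' <-; by rewrite ccons_row.
Qed.

Lemma bnd_Zge n (lam : bounds n) : bnd (Zge lam).
Proof. by exists lam. Qed.


Lemma bnd_bigU (I : eqType) n (D : set I) (E : I -> set 'cV[int]_n) :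
  finite_set D -> (forall i, D i -> bnd (E i)) -> bnd (\bigcup_(i in D) E i).
Proof.
move=> /finite_seqP[s ->]; elim: s => [|i s IHs] EP.
  by apply: bndW (@bnd0 n) => l [].
apply: bndW (bndU (EP i _) (IHs _)) => [l [j]||j /= js]; last first.
- by apply: EP; rewrite /= inE js orbT.
- by rewrite /= inE eqxx.
- by rewrite /= inE => /predU1P[-> Ei|js Ej]; [left|right; exists j].
Qed.

Lemma bnd_finite n (E : set 'cV[int]_n) : finite_set E -> bnd E.
Proof.
move=> Efin; apply: bndW (bnd_bigU Efin (fun l _ => bnd1 l)) => l El.
by exists l.
Qed.

Lemma finite_int_itv (N M : int) : finite_set [set j : int | N <= j <= M].
Proof.
apply: (@sub_finite_set _ _ [set N + i%:Z | i in `I_(absz (M - N)).+1]).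
  move=> j /= /andP[Nj jM]; exists (absz (j - N)); rewrite /=; lia.
exact/finite_image/finite_II.
Qed.

(** Last coordinates are bounded below on both sides, so each slice of the sum set is contained in a
    finite union of sums of slices. *)
Lemma bnd_sum n (E F : set 'cV[int]_n) :
  bnd E -> bnd F -> bnd [set l + l' | l in E & l' in F].
Proof.
elim: n E F => [|n IHn] E F; first by exists tt.
move=> /bndS[[N EN] sE] /bndS[[M FM] sF]; apply/bndS; split=> [|j].
  exists (N + M) => _ [l El [l' Fl' <-]]; rewrite mxE.
  by apply: lerD; [apply: EN|apply: FM].
have := @bnd_bigU _ _ _ (fun a => [set l + l' | l in slice E a & l' in slice F (j - a)])
  (finite_int_itv N (j - M)) (fun a _ => IHn _ _ (sE a) (sF (j - a))).
apply: bndW => l [l1 El1 [l2 Fl2 e]].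
exists (l1 ord_max 0).
  have := EN _ El1; have := FM _ Fl2.
  have := congr1 (fun v : 'cV_n.+1 => v ord_max 0) e; rewrite /= mxE ccons_last /=; lia.
exists (row' ord_max l1); first by rewrite /slice/= cconsK.
exists (row' ord_max l2).
  rewrite /slice/= (_ : j - _ = l2 ord_max 0) ?cconsK//.
  by have := congr1 (fun v : 'cV_n.+1 => v ord_max 0) e; rewrite /= mxE ccons_last /=; lia.
by rewrite -(ccons_row l j) -e; apply/colP => i; rewrite !mxE.
Qed.

Definition neg n (E : set 'cV[int]_n) : set 'cV[int]_n := [set l | E (- l)].

Lemma bnd_fin n (E F : set 'cV[int]_n) : bnd E -> bnd F -> finite_set (E `&` neg F).
Proof.
elim: n E F => [|n IHn] E F.
  move=> _ _; apply: (@sub_finite_set _ _ [set 0]); last exact: finite_set1.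
  by move=> l _; apply/matrixP => -[].
move=> /bndS[[N EN] sE] /bndS[[M FM] sF].
apply: (@sub_finite_set _ _ (\bigcup_(j in [set j : int | N <= j <= - M])
    [set ccons l j | l in slice E j `&` neg (slice F (- j))])).
  move=> l [El Fl]; exists (l ord_max 0) => /=.
    by have := EN _ El; have := FM _ Fl; rewrite mxE; move: (l ord_max 0) => a; lia.
  exists (row' ord_max l); last exact: cconsK.
  by split; rewrite /neg /slice /= -?cconsN ?cconsN cconsK.
apply: bigcup_finite; first exact: finite_int_itv.
by move=> j _; apply/finite_image/IHn.
Qed.

(** Converse of [bnd_fin]. It serves for supports of infinite sums, where no explicit bound is at
    hand. *)
Lemma bnd_dual n (E : set 'cV[int]_n) :
  (forall F, bnd F -> finite_set (E `&` neg F)) -> bnd E.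
Proof.
elim: n E => [|n IHn] E EP; first by exists tt.
apply/bndS; split=> [|j]; last first.
  apply: IHn => F Fb.
  pose F' : set 'cV[int]_n.+1 := [set ccons l (- j) | l in F].
  have F'b : bnd F'.
    apply/bndS; split=> [|k].
      by exists (- j) => _ [l _ <-]; rewrite ccons_last.
    by apply: bndW Fb => l [l' Fl' /ccons_eq[<-]].
  apply: (@sub_finite_set _ _ [set row' ord_max l | l in E `&` neg F']).
    move=> l [El Fl]; exists (ccons l j); last exact: ccons_row.
    by split=> //; exists (- l) => //; rewrite cconsN.
  exact/finite_image/EP.
apply: contrapT => /forallNP unbE.
have /choice[x xP] : forall k : nat, exists l, E l /\ l ord_max 0 < - k%:Z.
  move=> k; have /existsNP[l /not_implyP[El /negP]] := unbE (- k%:Z).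
  by rewrite -ltNge => lk; exists l.
(* The points [- x k] form a bounded set: their last coordinates exceed [k], so each slice is
   finite. Hence the [x k] would lie in a finite set, although their last coordinates tend to minus
   infinity. *)
have : finite_set (E `&` neg [set - x k | k in [set: nat]]).
  apply: EP; apply/bndS; split=> [|j].
    by exists 0 => _ [k _ <-]; have [_] := xP k; rewrite mxE; move: (x k ord_max 0) => a; lia.
  apply: bnd_finite.
  apply: (@sub_finite_set _ _ [set row' ord_max (- x k) | k in `I_(absz j)]).
    move=> l [k _ e]; exists k; last by rewrite e ccons_row.
    have [_] := xP k; have := congr1 (fun v : 'cV_n.+1 => v ord_max 0) e.
    by rewrite /= mxE ccons_last /=; move: (x k ord_max 0) => a; lia.
  exact/finite_image/finite_II.
move=> /bnd_finite/bndS[[N NP] _].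
have [Ex xN] := xP (absz N).
have : N <= x (absz N) ord_max 0 by apply: NP; split=> //; exists (absz N).
by move: xN; move: (x _ _ _) => a; lia.
Qed.

(** * Coefficients of iterated Laurent series *)

Section FiniteSums.
Variable V : pzRingType.

Lemma eq0_out (I : Type) (D : set I) (F : I -> V) i :
  (forall i, F i <> 0 -> D i) -> ~ D i -> F i = 0.
Proof. by move=> FD Di; apply: contrapT => /FD. Qed.

Lemma fsum_on (I : choiceType) (D : set I) (F : I -> V) :
  (forall i, F i <> 0 -> D i) ->
  \sum_(i \in [set: I]) F i = \sum_(i \in D) F i.
Proof.
move=> FD; apply/esym/fsbig_widen => // i [_ /= Di].
by apply: contrapT => /FD.
Qed.

(** A sum with infinite support is 0 by convention, so finite sets that contain the nonzero terms
    have to be supplied. *)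
Lemma fsum_exch (I J : choiceType) (D : set I) (E : set J) (F : I -> J -> V) :
  finite_set D -> finite_set E -> (forall i j, F i j <> 0 -> D i /\ E j) ->
  \sum_(i \in [set: I]) \sum_(j \in [set: J]) F i j =
  \sum_(j \in [set: J]) \sum_(i \in [set: I]) F i j.
Proof.
move=> Df Ef FDE.
rewrite (@fsum_on _ D); last first.
  by move=> i; apply: contra_notP => Di; apply: fsbig1 => j _; apply: contrapT => /FDE[].
rewrite [RHS](@fsum_on _ E); last first.
  by move=> j; apply: contra_notP => Ej; apply: fsbig1 => i _; apply: contrapT => /FDE[].
transitivity (\sum_(i \in D) \sum_(j \in E) F i j).
  by apply: eq_fsbigr => i _; apply: fsum_on => j /FDE[].
rewrite exchange_fsbig//; apply: eq_fsbigr => j _.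
by apply/esym/fsum_on => i /FDE[].
Qed.

Lemma fsum_mull (I : choiceType) (D : set I) (a : V) (F : I -> V) :
  finite_set D -> (forall i, F i <> 0 -> D i) ->
  a * (\sum_(i \in [set: I]) F i) = \sum_(i \in [set: I]) a * F i.
Proof.
move=> Df FD; rewrite (@fsum_on _ D)// [RHS](@fsum_on _ D); last first.
  by move=> i; apply: contra_notP => Di; rewrite (eq0_out FD Di) mulr0.
by rewrite !fsbig_finite// mulr_sumr.
Qed.

Lemma fsum_mulr (I : choiceType) (D : set I) (a : V) (F : I -> V) :
  finite_set D -> (forall i, F i <> 0 -> D i) ->
  (\sum_(i \in [set: I]) F i) * a = \sum_(i \in [set: I]) F i * a.
Proof.
move=> Df FD; rewrite (@fsum_on _ D)// [RHS](@fsum_on _ D); last first.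
  by move=> i; apply: contra_notP => Di; rewrite (eq0_out FD Di) mul0r.
by rewrite !fsbig_finite// mulr_suml.
Qed.

Lemma fsum_add (I : choiceType) (D : set I) (F G : I -> V) :
  finite_set D -> (forall i, F i <> 0 -> D i) -> (forall i, G i <> 0 -> D i) ->
  \sum_(i \in [set: I]) (F i + G i) =
  \sum_(i \in [set: I]) F i + \sum_(i \in [set: I]) G i.
Proof.
move=> Df FD GD; rewrite !(@fsum_on _ D) ?fsbig_split// => i.
apply: contra_notP => Di.
by rewrite (eq0_out FD Di) (eq0_out GD Di) addr0.
Qed.

Lemma fsum_single (I : choiceType) (i0 : I) (F : I -> V) :
  (forall i, i != i0 -> F i = 0) -> \sum_(i \in [set: I]) F i = F i0.
Proof.
move=> F0; rewrite (@fsum_on _ [set i0]) ?fsbig_set1// => i.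
by apply: contra_notP => /eqP/F0.
Qed.

Lemma fsum_ccons n (D : set 'cV[int]_n.+1) (F : 'cV[int]_n.+1 -> V) :
  finite_set D -> (forall i, F i <> 0 -> D i) ->
  \sum_(l \in [set: 'cV[int]_n.+1]) F l =
  \sum_(j \in [set: int]) \sum_(l \in [set: 'cV[int]_n]) F (ccons l j).
Proof.
move=> Df FD.
pose Dj := [set (l : 'cV[int]_n.+1) ord_max 0 | l in D]; pose Dl := [set row' ord_max l | l in D].
have Djf : finite_set Dj by exact: finite_image.
have Dlf : finite_set Dl by exact: finite_image.
have FDc j l : F (ccons l j) <> 0 -> Dj j /\ Dl l.
  by move=> /FD Dc; split; exists (ccons l j); rewrite ?ccons_last ?ccons_row.
transitivity (\sum_(j \in Dj) \sum_(l \in Dl) F (ccons l j)); last first.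
  rewrite [RHS](@fsum_on _ Dj); last first.
    by move=> j; apply: contra_notP => Di; apply: fsbig1 => l _; apply: contrapT => /FDc[].
  by apply: eq_fsbigr => j _; apply/esym/fsum_on => l /FDc[].
rewrite pair_fsbig//.
rewrite (@fsum_on _ [set ccons p.2 p.1 | p in Dj `*` Dl]); last first.
  move=> l Fl; exists (l ord_max 0, row' ord_max l); last exact: cconsK.
  by apply: FDc; rewrite cconsK.
by rewrite fsbig_image// => -[j l] [j' l'] _ _ /ccons_eq[/= -> ->].
Qed.

End FiniteSums.

Lemma fsum_eq0 (V : nmodType) (I : choiceType) (F : I -> V) :
  \sum_(i \in [set: I]) F i <> 0 -> exists i, F i <> 0.
Proof.
by apply: contra_notP => /forallNP F0; apply: fsbig1 => i _; apply: contrapT (F0 i).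
Qed.

Arguments coef : simpl never.

Section Coef.
Variable A : comPzRingType.

Lemma coefS n (f : laurent (itlaurent_ring A n)) (l : 'cV[int]_n) j :
  coef (f : itlaurent A n.+1) (ccons l j) = coef (f j : itlaurent A n) l.
Proof. by rewrite /coef /= ccons_last ccons_row. Qed.

Lemma coef_inj n (f g : itlaurent A n) : (forall l, coef f l = coef g l) -> f = g.
Proof.
elim: n f g => [f g /(_ 0)//|n IHn] f g fg.
apply/laurentP => j; apply: IHn => l.
by have := fg (ccons l j); rewrite !(@coefS n).
Qed.

Lemma supp_bnd n (f : itlaurent A n) : bnd (supp f).
Proof.
elim: n f => [|n IHn] f; first by exists tt.
apply/bndS; split=> [|j].
  have [N fN] := laurent_bnd (f : laurent _); exists N => l.
  rewrite /supp /= -(cconsK l) (@coefS n) ccons_last leNgt; apply: contra => /fN ->.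
  by rewrite (coef0 A).
by apply: bndW (IHn ((f : laurent _) j)) => l; rewrite /supp /slice /= (@coefS n).
Qed.

(** Converse of [supp_bnd]: a series may be given by its coefficients on Z^n instead of one variable
    at a time. *)
Lemma ofcoef n (a : 'cV[int]_n -> A) : bnd [set l | a l <> 0] ->
  exists f : itlaurent A n, forall l, coef f l = a l.
Proof.
elim: n a => [|n IHn] a; first by exists (a 0) => l; rewrite (flatmx0 l).
move=> /bndS[[N aN] sa].
have /choice[F FP] : forall j, exists f : itlaurent A n, forall l, coef f l = a (ccons l j).
  by move=> j; apply: IHn; apply: sa.
have FL : (F : int -> itlaurent_ring A n) \in @laurent_pred (itlaurent_ring A n).
  apply/asboolP; exists N => j jN; apply: coef_inj => l; rewrite (coef0 A) FP.
  apply: contrapT => /aN; rewrite ccons_last; apply/negP; by rewrite -ltNge.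
by exists (Laurent FL) => l; rewrite -(cconsK l) (@coefS n) FP.
Qed.

Lemma coef_sum n (I : Type) (r : seq I) (P : pred I) (F : I -> itlaurent A n) l :
  coef (\sum_(i <- r | P i) F i) l = \sum_(i <- r | P i) coef (F i) l.
Proof.
apply: (big_morph (fun f : itlaurent A n => coef f l)); first by move=> f g; exact: coefD.
exact: coef0.
Qed.

End Coef.

Section CoefM.
Variable A : comPzRingType.

Lemma supp_fin n (f g : itlaurent A n) k :
  finite_set (supp f `&` [set l | supp g (k - l)]).
Proof.
have := bnd_fin (bnd_sum (bnd1 (- k)) (supp_bnd f)) (supp_bnd g).
move=> /(finite_image (fun l => l + k)); apply: sub_finite_set => l [fl gl].
exists (l - k); last by rewrite subrK.
split; last by rewrite /neg /= opprB.
by exists (- k) => //; exists l => //; rewrite addrC.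
Qed.

Lemma mul_neq0 (x y : A) : x * y <> 0 -> x != 0 /\ y != 0.
Proof.
by move=> xy; split; apply: contra_notN xy => /eqP ->; rewrite ?mul0r ?mulr0.
Qed.

(** The product is defined one variable at a time; splitting off the last coordinate, which runs
    over the finite window [r], turns it into a convolution on Z^n. *)
Lemma coefM n (f g : itlaurent A n) k :
  coef (f * g) k = \sum_(l \in [set: 'cV[int]_n]) coef f l * coef g (k - l).
Proof.
elim: n f g k => [|n IHn] f g k.
  by rewrite (@fsum_single _ _ 0)// => i /eqP[]; apply/matrixP => -[].
rewrite (fsum_ccons (supp_fin f g k)); last by move=> l /mul_neq0[].
rewrite -(cconsK k); move: (row' _ _) (k ord_max 0) => {}k K.
rewrite (@coefS A n).
have [a fa] := laurent_bnd (f : laurent _); have [b gb] := laurent_bnd (g : laurent _).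
pose m := (absz (K - a - b)%R).+1.
have Km : K - a - b < m%:Z by rewrite /m; lia.
pose r := [seq a + i%:Z | i <- iota 0 m].
have ru : uniq r by rewrite map_inj_uniq ?iota_uniq// => i j; lia.
rewrite [LHS](congr1 (fun x => coef x k) (lcoefME fa gb Km)).
rewrite (@coef_sum A n).
rewrite (@fsum_on _ _ [set` r]); last first.
  move=> j /fsum_eq0[l /mul_neq0[]].
  rewrite -cconsB !(@coefS A n) => fl gl /=.
  have aj : a <= j by rewrite leNgt; apply: contra fl => /fa ->; rewrite (coef0 A).
  have bj : b <= K - j by rewrite leNgt; apply: contra gl => /gb ->; rewrite (coef0 A).
  apply/mapP; exists (absz (j - a)%R); last by lia.
  by rewrite mem_iota; lia.
rewrite -fsbig_seq// big_map (_ : iota 0 m = index_iota 0 m); last first.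
  by rewrite /index_iota subn0.
rewrite big_mkord; apply: eq_bigr => i _.
rewrite IHn; apply: eq_fsbigr => l _.
rewrite -cconsB !(@coefS A n); congr (_ * coef ((g : laurent _) _) _); lia.
Qed.

Lemma coefC n a (l : 'cV[int]_n) :
  coef (itconst A n a : itlaurent A n) l = if l == 0 then a else 0.
Proof.
elim: n l => [|n IHn] l; first by rewrite (flatmx0 l) eqxx.
rewrite -(cconsK l); move: (row' _ _) (l ord_max 0) => {}l j.
rewrite (@coefS A n) /=.
have -> : (ccons l j == 0) = (j == 0) && (l == 0).
  apply/eqP/andP => [e|[/eqP-> /eqP->]].
    by have /ccons_eq[-> ->] : ccons l j = ccons 0 0
      by rewrite e; apply/colP => i; rewrite !mxE; case: unliftP => *; rewrite ?mxE.
  by apply/colP => i; rewrite !mxE; case: unliftP => *; rewrite ?mxE.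
by case: eqP => _ /=; rewrite ?(coef0 A)//; exact: IHn.
Qed.

Lemma coefZ n a (f : itlaurent A n) l : coef (a *: f) l = a * coef f l.
Proof.
rewrite (_ : a *: f = (itconst A n a : itlaurent A n) * f)// coefM.
rewrite (@fsum_single _ _ 0) ?coefC ?eqxx ?subr0// => i /negPf i0.
by rewrite coefC i0 mul0r.
Qed.

End CoefM.

Section Mono.
Variable A : comPzRingType.

Fixpoint mono n : 'cV[int]_n -> itlaurent A n :=
  if n is n'.+1 return 'cV[int]_n -> itlaurent A n then fun l =>
    lmonom (mono (row' ord_max l) : itlaurent_ring A n') (l ord_max 0)
  else fun=> (1 : A).

Lemma coef_mono n (l k : 'cV[int]_n) : coef (mono l) k = (k == l)%:R.
Proof.
elim: n l k => [|n IHn] l k.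
  by rewrite (_ : k = l) ?eqxx//; apply/matrixP => -[].
rewrite -(cconsK k) (@coefS A n) /=.
case: eqP => [e|ne].
  rewrite IHn; congr (nat_of_bool _)%:R; apply/eqP/eqP => [e'|e'].
    by rewrite e e' cconsK.
  by rewrite -e' ccons_row.
by rewrite (coef0 A); case: eqP => // e; case: ne; rewrite -e ccons_last.
Qed.

Lemma mono_unique n (f : itlaurent A n) l :
  (forall k, coef f k = (k == l)%:R) -> f = mono l.
Proof. by move=> fl; apply: coef_inj => k; rewrite fl coef_mono. Qed.

Lemma coef_monoM n (f : itlaurent A n) l k : coef (mono l * f) k = coef f (k - l).
Proof.
rewrite coefM (@fsum_single _ _ l) ?coef_mono ?eqxx ?mul1r// => i /negPf il.
by rewrite coef_mono il mul0r.
Qed.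

Lemma monoD n (l l' : 'cV[int]_n) : mono (l + l') = mono l * mono l'.
Proof.
apply/esym/mono_unique => k; rewrite coef_monoM coef_mono.
by rewrite subr_eq addrC.
Qed.

Lemma mono0 n : mono (0 : 'cV[int]_n) = 1.
Proof. by apply/esym/mono_unique => k; exact: coef_ring1. Qed.

Lemma tvar_mono n (i : 'I_n) : tvar A i = mono (delta_mx i 0).
Proof. by apply: mono_unique => k; rewrite coef_tvar. Qed.

Lemma supp_mono n (l : 'cV[int]_n) : supp (mono l) `<=` [set l].
Proof. by move=> k; rewrite /supp /= coef_mono; case: (k =P l) => // _; rewrite eqxx. Qed.

Lemma suppM n (f g : itlaurent A n) :
  supp (f * g) `<=` [set l + l' | l in supp f & l' in supp g].
Proof.
move=> k /eqP; rewrite coefM => /fsum_eq0[l /mul_neq0[fl gl]].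
by exists l => //; exists (k - l) => //; rewrite addrC subrK.
Qed.

End Mono.

Lemma itmap_mono (A B : comPzRingType) (g : {rmorphism A -> B}) n (l : 'cV[int]_n) :
  itmap g n (mono A l) = mono B l.
Proof. by apply: mono_unique => k; rewrite coef_itmap coef_mono rmorph_nat. Qed.

(** * Homomorphisms attached to summable families *)

(** Bundles a morphism whose underlying function comes from choice inside a proof. *)
Lemma rmorphism_pack (R S : comPzRingType) (f : R -> S) :
  zmod_morphism f -> monoid_morphism f ->
  exists g : {rmorphism R -> S}, g =1 f.
Proof.
move=> fB fM.
pose a := GRing.isZmodMorphism.Build R S f fB.
pose b := GRing.isMonoidMorphism.Build R S f fM.
by exists (HB.pack_for {rmorphism R -> S} f a b).
Qed.

Section HomOfFamily.
Variables (A : comPzRingType) (n m : nat) (X : 'cV[int]_n -> itlaurent A m).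

(* X l tends to 0 as l leaves the sets -Z^n_lambda: this is what continuity of f |-> \sum_l f_l X_l
   requires. *)
Definition summable := forall F : set 'cV[int]_m, bnd F ->
  bnd [set l | exists2 k, F k & coef (X (- l)) (- k) <> 0].

Hypothesis X_summable : summable.

Lemma summable_fin (f : itlaurent A n) k :
  finite_set (supp f `&` [set l | coef (X l) k <> 0]).
Proof.
apply: sub_finite_set (bnd_fin (supp_bnd f) (X_summable (bnd1 (- k)))) => l [fl Xl].
by split=> //; exists (- k) => //; rewrite !opprK.
Qed.

(** By [bnd_dual] it is enough to meet [neg F] in a finite set: summability leaves finitely many [l]
    in the support of [f], and each [X l] has finitely many exponents in [neg F]. *)
Lemma summable_image_bnd (f : itlaurent A n) :
  bnd [set k | exists2 l, supp f l & coef (X l) k <> 0].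
Proof.
apply: bnd_dual => F Fb.
have Gf := bnd_fin (supp_bnd f) (X_summable Fb).
apply: sub_finite_set (bigcup_finite Gf (fun l _ => bnd_fin (supp_bnd (X l)) Fb)).
move=> k [[l fl /eqP Xl] Fk]; exists l => //; split=> //.
by exists (- k) => //; rewrite !opprK; apply/eqP.
Qed.

Definition sum_fun (f : itlaurent A n) k :=
  \sum_(l \in [set: 'cV[int]_n]) coef f l * coef (X l) k.

Lemma sum_ex f : exists g : itlaurent A m, forall k, coef g k = sum_fun f k.
Proof.
apply: ofcoef; apply: bndW (summable_image_bnd f) => k /fsum_eq0[l /mul_neq0[fl Xl]].
by exists l => //; apply/eqP.
Qed.

Lemma sum_on (f : itlaurent A n) k l : coef f l * coef (X l) k <> 0 ->
  (supp f `&` [set l | coef (X l) k <> 0]) l.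
Proof. by move=> /mul_neq0[fl Xl]; split=> //; apply/eqP. Qed.

Lemma sum_funD f g k : sum_fun (f + g) k = sum_fun f k + sum_fun g k.
Proof.
have fin2 : finite_set ((supp f `&` [set l | coef (X l) k <> 0]) `|`
    (supp g `&` [set l | coef (X l) k <> 0])).
  by rewrite finite_setU; split; apply: summable_fin.
rewrite /sum_fun -(fsum_add fin2).
- by apply: eq_fsbigr => l _; rewrite coefD mulrDl.
- by move=> l /sum_on; left.
- by move=> l /sum_on; right.
Qed.

Lemma sum_funZ a f k : sum_fun (a *: f) k = a * sum_fun f k.
Proof.
rewrite /sum_fun (fsum_mull a (summable_fin f k)); last by move=> l /sum_on.
by apply: eq_fsbigr => l _; rewrite coefZ mulrA.
Qed.

Lemma sum_fun_mono l k : sum_fun (mono A l) k = coef (X l) k.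
Proof.
rewrite /sum_fun (@fsum_single _ _ l) ?coef_mono ?eqxx ?mul1r// => i /negPf il.
by rewrite coef_mono il mul0r.
Qed.

Hypothesis X_add : forall l l', X (l + l') = X l * X l'.

(** Both sides expand to the sum over i and j of f_i g_j times the coefficient of X_i X_j at [k].
    The finite sets [P], [Df] and [Dg] contain all indices of nonzero terms, which justifies the
    exchanges of sums on the right. *)
Lemma sum_funM f g k : sum_fun (f * g) k =
  \sum_(p \in [set: 'cV[int]_m]) sum_fun f p * sum_fun g (k - p).
Proof.
pose I (f : itlaurent A n) := [set p | exists2 l, supp f l & coef (X l) p <> 0].
have If : finite_set [set p | I f p /\ I g (k - p)].
  have := bnd_fin (bnd_sum (bnd1 (- k)) (summable_image_bnd f)) (summable_image_bnd g).
  move=> /(finite_image (fun l => l + k)); apply: sub_finite_set => p [fp gp].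
  exists (p - k); last by rewrite subrK.
  split; last by rewrite /neg /= opprB.
  by exists (- k) => //; exists p => //; rewrite addrC.
pose P := [set p | I f p /\ I g (k - p)].
pose Sf p := supp f `&` [set l | coef (X l) p <> 0].
pose Sg p := supp g `&` [set l | coef (X l) p <> 0].
pose Df := \bigcup_(p in P) Sf p.
pose Dg := \bigcup_(p in P) Sg (k - p).
have Dff : finite_set Df by apply: bigcup_finite => // p _; apply: summable_fin.
have Dgf : finite_set Dg by apply: bigcup_finite => // p _; apply: summable_fin.
have mul4 (a b c d : A) : a * b * (c * d) <> 0 ->
    [/\ a != 0, b <> 0, c != 0 & d <> 0].
  move=> /mul_neq0[/eqP/mul_neq0[? /eqP ?] /eqP/mul_neq0[? /eqP ?]]; split=> //.
have trip p i j : coef f i * coef (X i) p * (coef g j * coef (X j) (k - p)) <> 0 ->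
    [/\ P p, Df i & Dg j].
  move=> /mul4[fi Xi gj Xj].
  have Pp : P p by split; [exists i|exists j].
  by split=> //; [exists p|exists p].
transitivity (\sum_(i \in [set: 'cV[int]_n]) \sum_(j \in [set: 'cV[int]_n])
    coef f i * coef g j * coef (X (i + j)) k).
  rewrite /sum_fun.
  under eq_fsbigr => l _.
    rewrite coefM (fsum_mulr _ (supp_fin f g l)); last by move=> i /mul_neq0[].
    over.
  have Sfin : finite_set [set l | (exists i j, [/\ supp f i, supp g j & i + j = l]) /\
      coef (X l) k <> 0].
    have fgb := bnd_sum (supp_bnd f) (supp_bnd g).
    apply: sub_finite_set (bnd_fin fgb (X_summable (bnd1 (- k)))).
    move=> _ [[i [j [fi gj <-]]] Xl]; split; first by exists i => //; exists j.
    by exists (- k) => //; rewrite !opprK.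
  rewrite (@fsum_exch _ _ _ _ (\bigcup_(l in [set l | (exists i j, [/\ supp f i, supp g j & i + j = l]) /\
      coef (X l) k <> 0]) (supp f `&` [set i | supp g (l - i)])) _ Sfin); first last.
  - move=> l i /mul_neq0[/eqP/mul_neq0[fi gj] /eqP Xl].
    have Sl : (exists i0 j, [/\ supp f i0, supp g j & i0 + j = l]) /\ coef (X l) k <> 0.
      by split=> //; exists i, (l - i); split=> //; rewrite addrC subrK.
    by split=> //; exists l.
  - by apply: bigcup_finite => // l _; exact: supp_fin.
  apply: eq_fsbigr => i _.
  rewrite (@reindex_fsbigT _ _ _ _ _ (fun j => i + j)); last first.
    by exists (fun j => - i + j) => j; rewrite ?addKr ?addNKr.
  by apply: eq_fsbigr => j _; rewrite [i + j]addrC addrK.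
transitivity (\sum_(p \in [set: 'cV[int]_m]) \sum_(i \in [set: 'cV[int]_n])
  \sum_(j \in [set: 'cV[int]_n])
    coef f i * coef (X i) p * (coef g j * coef (X j) (k - p))); last first.
  apply: eq_fsbigr => p _; rewrite /sum_fun.
  rewrite (fsum_mulr _ (summable_fin f p)); last by move=> l /sum_on.
  apply: eq_fsbigr => i _.
  by rewrite (fsum_mull _ (summable_fin g (k - p)))// => l /sum_on.
rewrite (fsum_exch If Dff); last first.
  by move=> p i /fsum_eq0[j /trip[]].
apply: eq_fsbigr => i _.
rewrite (fsum_exch If Dgf); last by move=> p j /trip[].
apply: eq_fsbigr => j _.
rewrite X_add coefM (fsum_mull _ (supp_fin (X i) (X j) k)); last by move=> p /mul_neq0[].
by apply: eq_fsbigr => p _; rewrite mulrACA.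
Qed.

Hypothesis X0 : X 0 = 1.

Lemma hom_of_family :
  exists phi : calgHom A n m, forall l, phi (mono A l) = X l.
Proof.
have /choice[phi phiP] := sum_ex.
have phiD f g : phi (f + g) = phi f + phi g.
  by apply: coef_inj => k; rewrite coefD !phiP sum_funD.
have phiB : zmod_morphism phi.
  by move=> f g; apply: (@addIr _ (phi g)); rewrite -phiD !subrK.
have phi_mono l : phi (mono A l) = X l.
  by apply: coef_inj => k; rewrite phiP sum_fun_mono.
have phiM : monoid_morphism phi.
  split=> [|f g]; first by rewrite -(mono0 A n) phi_mono.
  by apply: coef_inj => k; rewrite phiP sum_funM coefM; apply: eq_fsbigr => p _; rewrite !phiP.
have [psi psiP] := rmorphism_pack phiB phiM.
have psiZ : scalable psi.
  by move=> a f; rewrite !psiP; apply: coef_inj => k; rewrite coefZ !phiP sum_funZ.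
suff psiC : continuous psi by exists (CAlgHom psiZ psiC) => l /=; rewrite psiP.
move=> f W [mu muW]; have [lam lamP] := X_summable (bnd_Zge mu).
exists lam => _ [h /UzeroE hlam <-]; apply: muW; exists (psi h); last by rewrite rmorphD.
apply/UzeroE => k muk; rewrite psiP phiP; apply: fsbig1 => l _.
apply: contrapT => /mul_neq0[/eqP hl /eqP Xl]; apply: hl.
rewrite -[l]opprK; apply: hlam; apply: lamP; exists k => //.
by rewrite opprK.
Qed.

End HomOfFamily.

(** If [l] is outside [Zge lam], the monomial with exponent [- l] lies in [Uzero lam]; so continuity
    at 0 confines the relevant [l] to some [Zge lam]. *)
Lemma calgHom_summable (A : comPzRingType) n m (phi : calgHom A n m) :
  summable (fun l => phi (mono A l)).
Proof.
move=> F [mu Fmu].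
have : nbhs (phi 0) (@Uzero A m mu).
  by rewrite rmorph0; exists mu => _ [h hmu <-]; rewrite add0r.
move=> /(@calg_continuous _ _ _ phi 0)[lam lamP]; exists lam => l [k Fk].
apply: contra_notP => lamk.
have /lamP : [set 0 + h | h in Uzero lam] (mono A (- l)).
  exists (mono A (- l)); last by rewrite add0r.
  apply/UzeroE => l' lam'; rewrite coef_mono; case: eqP => // /oppr_inj e.
  by case: lamk; rewrite -e.
by move=> /UzeroE; apply; apply: Fmu.
Qed.

(** * Nilpotent elements, primes and units of Laurent series *)

Record is_ideal (A : comPzRingType) (I : set A) : Prop := IsIdeal {
  ideal0 : I 0;
  idealD : forall a b, I a -> I b -> I (a + b);
  idealM : forall a b, I b -> I (a * b)
}.

Section Ideals.
Variables (A : comPzRingType) (I : set A) (II : is_ideal I).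

Lemma idealMr a b : I a -> I (a * b).
Proof. by move=> Ia; rewrite mulrC; apply: idealM. Qed.

Lemma idealN a : I a -> I (- a).
Proof. by move=> Ia; rewrite -mulN1r; apply: idealM. Qed.

Lemma idealB a b : I a -> I b -> I (a - b).
Proof. by move=> Ia Ib; apply: idealD => //; apply: idealN. Qed.

Lemma ideal_sum (J : Type) (r : seq J) (P : pred J) (F : J -> A) :
  (forall i, P i -> I (F i)) -> I (\sum_(i <- r | P i) F i).
Proof. by move=> IF; elim/big_ind: _ => //; [exact: ideal0|exact: idealD]. Qed.

End Ideals.

Lemma prime_is_ideal (A : comPzRingType) (p : set A) : prime_ideal p -> is_ideal p.
Proof. by case. Qed.

(** Applied to the powers of an element, to obtain a prime, and to a single element, to obtain a
    connected quotient. *)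
Lemma maximal_avoiding (A : comPzRingType) (S : set A) : ~ S 0 ->
  exists I : set A, [/\ is_ideal I, forall s, S s -> ~ I s &
    forall x, ~ I x -> exists i r, I i /\ S (i + r * x)].
Proof.
move=> S0.
pose P (X : set A) := [/\ forall a b, X a -> X b -> X (a + b),
  forall a b, X b -> X (a * b) & forall s, S s -> ~ X s].
have [F FP Ftot|I [[ID IM IS] Imax]] := @Zorn_bigcup A P.
  split=> [a b [X FX Xa] [Y FY Yb]|a b [X FX Xb]|s Ss [X FX Xs]].
  - have [XY|YX] := Ftot _ _ FX FY.
      by exists Y => //; have [YD _ _] := FP _ FY; apply: YD => //; apply: XY.
    by exists X => //; have [XD _ _] := FP _ FX; apply: XD => //; apply: YX.
  - by exists X => //; have [_ XM _] := FP _ FX; apply: XM.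
  - by have [_ _ /(_ s Ss)] := FP _ FX.
(* [P] does not ask for 0, because the union of the empty chain is empty. A maximal [I] without 0
   would be empty, and then {0} would be strictly larger. *)
have I0 : I 0.
  apply: contrapT => I0; have /Imax : I `<` [set 0].
    split=> [x Ix|/(_ 0 erefl)//].
    by exfalso; apply: I0; rewrite -(mul0r x); apply: IM.
  apply; split=> [a b -> ->|a b ->|s Ss s0]; rewrite /= ?addr0 ?mulr0//.
  by apply: S0; rewrite -s0.
exists I; split=> // x Ix.
pose J := [set a | exists i r, I i /\ a = i + r * x].
have /Imax : I `<` J.
  split=> [i Ii|/(_ x)]; first by exists i, 0; rewrite mul0r addr0.
  by move=> /(_ _)/Ix; apply; exists 0, 1; rewrite mul1r add0r.
move=> /not_and3P[/existsNP[a /existsNP[b]]|/existsNP[a /existsNP[b]]|/existsNP[s]].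
- move=> /not_implyP[[i [r [Ii ->]]] /not_implyP[[j [s [Ij ->]]]]] [].
  by exists (i + j), (r + s); split; [exact: ID|ring].
- move=> /not_implyP[[i [r [Ii ->]]]] [].
  by exists (a * i), (a * r); split; [exact: IM|ring].
- by move=> /not_implyP[Ss /contrapT[i [r [Ii e]]]]; exists i, r; rewrite -e.
Qed.

Section Nilpotent.
Variable A : comPzRingType.
Implicit Types a b x : A.

(** An ideal maximal among those that avoid the powers of [x] is prime. *)
Lemma nil_primeP x : (forall p : set A, prime_ideal p -> p x) -> nilpotent x.
Proof.
move=> px; apply: contrapT => xn.
have [|I [II IS Imax]] := @maximal_avoiding A [set y | exists k, y = x ^+ k].
  by move=> [k /esym xk]; apply: xn; exists k.
have Ix : I x.
  apply: px; split=> [|a b|a b|I1|a b Iab]; [exact: ideal0|exact: idealD|exact: idealM| |].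
    by apply: (IS 1) => //; exists 0%N.
  apply: contrapT => /not_orP[/Imax[i [r [Ii [k ka]]]] /Imax[j [s [Ij [l lb]]]]].
  apply: (IS (x ^+ (k + l))); first by exists (k + l)%N.
  rewrite exprD -ka -lb.
  have -> : (i + r * a) * (j + s * b) = j * (i + r * a) + ((s * b) * i + (r * s) * (a * b)).
    by ring.
  have Ira : forall c, I (c * i) by move=> c; apply: idealM.
  apply: idealD => //; last by apply: idealD => //; apply: idealM.
  exact: idealMr.
by apply: (IS x) => //; exists 1%N.
Qed.

Lemma prime_nil (p : set A) x : prime_ideal p -> nilpotent x -> p x.
Proof.
move=> pP [k xk]; have : p (x ^+ k) by rewrite xk; apply: prime_ideal0.
elim: k {xk} => [|k IHk]; first by rewrite expr0 => /(prime_ideal1 pP).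
by rewrite exprS => /(prime_ideal_prime pP)[].
Qed.

Lemma nil_ideal : is_ideal [set x : A | nilpotent x].
Proof.
split=> [|a b an bn|a b bn]; first by exists 1%N.
  by apply: nil_primeP => p pP; apply: (prime_idealD pP); apply: prime_nil.
by apply: nil_primeP => p pP; apply: (prime_idealM pP); apply: prime_nil.
Qed.

Definition nil0 : nilpotent (0 : A) := ideal0 nil_ideal.
Definition nilD a b : nilpotent a -> nilpotent b -> nilpotent (a + b) :=
  @idealD _ _ nil_ideal a b.
Definition nilM a b : nilpotent b -> nilpotent (a * b) := @idealM _ _ nil_ideal a b.
Definition nilMr a b : nilpotent a -> nilpotent (a * b) := @idealMr _ _ nil_ideal a b.
Definition nilN a : nilpotent a -> nilpotent (- a) := @idealN _ _ nil_ideal a.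

Lemma invertible_mul a b : invertible a -> invertible b -> invertible (a * b).
Proof. by move=> [c ac] [d bd]; exists (c * d); rewrite mulrACA ac bd mulr1. Qed.

Lemma invertible_mull a b : invertible (a * b) -> invertible a.
Proof. by move=> [c abc]; exists (b * c); rewrite mulrA. Qed.

Lemma invertible_nilD a b : invertible a -> nilpotent b -> invertible (a + b).
Proof.
move=> [c ac] bn; apply: (@invertible_mull _ c); rewrite mulrDl ac.
by apply: invertible1D; apply: nilMr.
Qed.

Lemma invertible_nil a : invertible a -> nilpotent a -> 1 = 0 :> A.
Proof.
move=> [b ab] an; have [k] := nilMr b an; by rewrite ab expr1n.
Qed.

End Nilpotent.

Lemma nil_map (A B : comPzRingType) (g : {rmorphism A -> B}) a :
  nilpotent a -> nilpotent (g a).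
Proof. by move=> [k ak]; exists k; rewrite -rmorphXn ak rmorph0. Qed.

Lemma invertible_map (A B : comPzRingType) (g : {rmorphism A -> B}) a :
  invertible a -> invertible (g a).
Proof. by move=> [b ab]; exists (g b); rewrite -rmorphM ab rmorph1. Qed.

(** * Laurent series modulo an ideal of the coefficient ring *)

Section LaurentIdeal.
Variable R : comPzRingType.
Implicit Types (Q : set R) (f g : laurent R).

Lemma lcoef_sum (I : Type) (r : seq I) (P : pred I) (F : I -> laurent R) j :
  (\sum_(i <- r | P i) F i) j = \sum_(i <- r | P i) F i j.
Proof. by apply: (big_morph (fun f : laurent R => f j)). Qed.

(* Modulo Q((t)), f starts in degree a and g in degree b. *)
Lemma lmul_low Q f g (a b : int) : is_ideal Q ->
  (forall i, i < a -> Q (f i)) -> (forall i, i < b -> Q (g i)) ->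
  Q ((f * g) (a + b) - f a * g b).
Proof.
move=> QI fa gb.
have [a0 fa0] := laurent_bnd f; have [b0 gb0] := laurent_bnd g.
pose c := Num.min a0 a.
have fc : lsupp_ge f c by apply: lsupp_geW fa0; rewrite /c; lia.
pose n := (absz (a + b - c - b0)%R + absz (a - c)).+1.
rewrite (lcoefME (n := n) fc gb0); last by rewrite /n; lia.
have ltn : (absz (a - c) < n)%N by rewrite /n; lia.
rewrite (bigD1 (Ordinal ltn))//=.
rewrite (_ : c + _ = a); last by rewrite /c; lia.
rewrite (_ : a + b - c - _ = b); last by rewrite /c; lia.
rewrite addrAC subrr add0r; apply: ideal_sum => // i /eqP ne.
have [ia|ai] := ltP (c + i%:Z) a; first by apply: idealMr => //; apply: fa.
apply: idealM => //; apply: gb.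
suff : c + i%:Z <> a by lia.
by move=> e; apply: ne; apply/val_inj => /=; lia.
Qed.

Lemma lmul_lower Q f g (a b k : int) : is_ideal Q ->
  (forall i, i < a -> Q (f i)) -> (forall i, i < b -> Q (g i)) ->
  k < a + b -> Q ((f * g) k).
Proof.
move=> QI fa gb kab.
have fa' i : i < k - b -> Q (f i) by move=> ?; apply: fa; lia.
have := lmul_low QI fa' gb; rewrite subrK => Qk.
rewrite -[_ k](subrK (f (k - b) * g b)); apply: idealD => //.
by apply: idealMr => //; apply: fa; lia.
Qed.

Lemma lowest Q f : Q 0 -> ~ (forall j, Q (f j)) ->
  exists j, ~ Q (f j) /\ forall i, i < j -> Q (f i).
Proof.
move=> Q0 /existsNP[j0 Qj0].
have [a fa] := laurent_bnd f.
have aj0 : a <= j0 by rewrite leNgt; apply/negP => /fa e; apply: Qj0; rewrite e.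
have ex : exists k : nat, `[< ~ Q (f (a + k%:Z)) >].
  exists (absz (j0 - a)); apply/asboolP; rewrite (_ : a + _ = j0)//; lia.
case: (ex_minnP ex) => k /asboolP Qk kmin; exists (a + k%:Z); split=> // i iak.
have [ia|ai] := ltP i a; first by rewrite fa.
apply: contrapT => Qi.
have : (k <= absz (i - a))%N.
  by apply: kmin; apply/asboolP; rewrite (_ : a + _ = i)//; lia.
lia.
Qed.


(** Gauss's argument: the product of the lowest coefficients outside [Q] is, modulo [Q], a
    coefficient of [f * g]. *)
Lemma prime_lmul Q f g : prime_ideal Q -> (forall j, Q ((f * g) j)) ->
  (forall j, Q (f j)) \/ (forall j, Q (g j)).
Proof.
move=> QP Qfg; have QI := prime_is_ideal QP.
apply: contrapT => /not_orP[/(lowest (ideal0 QI))[a [Qa fa]]].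
move=> /(lowest (ideal0 QI))[b [Qb gb]].
have : Q (f a * g b).
  rewrite -[_ * _](subKr ((f * g) (a + b))).
  by apply: idealB => //; apply: lmul_low.
by case/(prime_ideal_prime QP).
Qed.

Lemma prime_lnil Q f : prime_ideal Q -> nilpotent f -> forall j, Q (f j).
Proof.
move=> QP [k fk].
have : forall j, Q ((f ^+ k) j) by move=> j; rewrite fk; apply: (prime_ideal0 QP).
elim: k {fk} => [/(_ 0)|k IHk]; first by move=> /(prime_ideal1 QP).
by rewrite exprS => /(prime_lmul QP)[].
Qed.

Lemma nil_lcoef f j : nilpotent f -> nilpotent (f j).
Proof. by move=> fn; apply: nil_primeP => Q QP; apply: prime_lnil. Qed.

Lemma lconst_coefM c f j : (lconst c * f) j = c * f j.
Proof.
have [a fa] := laurent_bnd f.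
rewrite (@lcoefME _ _ _ 0 a _ (absz (j - a)%R).+1)//; first last.
- by lia.
- exact: lmonom_supp.
rewrite big_ord_recl big1 ?addr0 => [|i _]; last by rewrite mul0r.
by congr (_ * f _); lia.
Qed.

Lemma lmonomM c d i j : lmonom c i * lmonom d j = lmonom (c * d) (i + j) :> laurent R.
Proof.
apply/laurentP => k.
rewrite (@lcoefME _ _ _ i j k (absz (k - i - j)%R).+1)//; try exact: lmonom_supp; last by lia.
rewrite big_ord_recl big1 ?addr0/= => [|l _]; last first.
  by rewrite /= (_ : _ == i = false) ?mul0r//; rewrite /bump /=; lia.
rewrite eqxx (_ : (k - i == j) = (k == i + j)); last by lia.
by case: eqP; rewrite ?mulr0.
Qed.

Lemma lsuppM f g a b : lsupp_ge f a -> lsupp_ge g b -> lsupp_ge (f * g) (a + b).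
Proof. exact: lmul_supp. Qed.

Lemma nil_lmonom c j : nilpotent c -> nilpotent (lmonom c j : laurent R).
Proof.
move=> [k ck]; exists k.+1.
suff -> : forall m, (lmonom c j : laurent R) ^+ m = lmonom (c ^+ m) (j * m%:Z).
  apply/laurentP => i; rewrite exprS ck mulr0 /=; by case: ifP.
elim=> [|m IHm]; first by rewrite !expr0 mulr0.
by rewrite !exprS IHm lmonomM (_ : j + _ = j * m.+1%:Z)//; lia.
Qed.

(** A finite sum of nilpotent monomials is nilpotent. Infinitely many nilpotent coefficients need
    not give a nilpotent series. *)
Lemma nil_finite f (a : int) m : lsupp_ge f a -> (forall j, a + m%:Z <= j -> f j = 0) ->
  (forall j, nilpotent (f j)) -> nilpotent f.
Proof.
move=> fa fm fn.
have -> : f = \sum_(i < m) lmonom (f (a + i%:Z)) (a + i%:Z).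
  apply/laurentP => j.
  rewrite lcoef_sum.
  have [ja|aj] := ltP j a.
    rewrite fa// big1// => i _ /=; case: eqP => // e; lia.
  have [mj|jm] := leP (a + m%:Z) j.
    rewrite fm// big1// => i _ /=; case: eqP => // e; have := ltn_ord i; lia.
  have ltm : (absz (j - a) < m)%N by lia.
  rewrite (bigD1 (Ordinal ltm))//= big1 ?addr0 => [|i /eqP ne].
    by rewrite (_ : a + _ = j) ?eqxx//; lia.
  by case: eqP => // e; case: ne; apply: val_inj => /=; lia.
by apply: ideal_sum => [|i _]; [exact: nil_ideal|exact: nil_lmonom].
Qed.

End LaurentIdeal.

(* The inverse is the geometric series, which is finite in each degree. *)
Lemma pos_inverse (R : comPzRingType) (p : laurent R) : lsupp_ge p 1 ->
  exists q : laurent R, (1 + p) * q = 1 /\ lsupp_ge q 0.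
Proof.
move=> p1.
have pX a : lsupp_ge ((- p) ^+ a) a%:Z.
  elim: a => [|a IHa]; first exact: lmonom_supp.
  have np : lsupp_ge (- p) 1 by move=> i i1; rewrite lcoefN p1 ?oppr0.
  rewrite exprS => k ka; apply: (lsuppM np IHa); lia.
pose T J := \sum_(0 <= a < J) (- p) ^+ a.
pose q0 (j : int) := if j < 0 then 0 else T (absz j).+1 j.
have q0L : q0 \in @laurent_pred R by apply/asboolP; exists 0 => j; rewrite /q0 => ->.
pose q := Laurent q0L; exists q; split; last by move=> j; rewrite /= /q0 => ->.
have T0 J : lsupp_ge (T J) 0.
  move=> j j0; rewrite /T lcoef_sum.
  by apply: big1 => a _; apply: pX; apply: lt_le_trans j0 _.
have TJ J (j : int) : j < J%:Z -> q j = T J j.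
  rewrite /= /q0; case: ifP => [j0 _|/negbT j0 jJ]; first by rewrite T0.
  rewrite /T !lcoef_sum [RHS](@big_cat_nat _ _ _ (absz j).+1)//; last by lia.
  rewrite [X in _ = _ + X]big_nat_cond [X in _ = _ + X]big1 ?addr0// => a.
  by rewrite andbT => /andP[ja _]; apply: pX; lia.
have p0 : lsupp_ge (1 + p) 0.
  by move=> i i0; rewrite lcoefD lcoef1 lt_eqF// p1 ?addr0//; lia.
have q0' : lsupp_ge q 0 by move=> i; rewrite /= /q0 => ->.
apply/laurentP => j.
have [j0|j0] := ltP j 0.
  by rewrite (lsuppM p0 q0') ?addr0// lcoef1 lt_eqF.
pose J := (absz j).+1.
have qT : lsupp_ge (q - T J) J%:Z by move=> i iJ; rewrite lcoefB (TJ _ _ iJ) subrr.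
have -> : q = T J + (q - T J) by rewrite addrC subrK.
rewrite mulrDr lcoefD (lsuppM p0 qT); last by rewrite /J; lia.
rewrite addr0; have -> : (1 + p) * T J = 1 - (- p) ^+ J.
  by rewrite /T big_mkord -[1 - _]opprB subrX1 -mulNr opprB opprK.
by rewrite lcoefB pX ?subr0// /J; lia.
Qed.

(** Connectedness of the spectrum, stated for idempotents up to nilpotents so that none has to be
    lifted. The zero ring is included. *)
Definition connected_ring (R : comPzRingType) :=
  forall e : R, nilpotent (e * (1 - e)) -> nilpotent e \/ nilpotent (1 - e).

(** The part [n] of [e] in degrees at most 0 is finite, hence nilpotent, and 1 minus the remaining
    part is invertible by the geometric series. So [1 - e] is invertible and can be cancelled. *)
Lemma pos_nil (R : comPzRingType) (e : laurent R) :
  (forall j, nilpotent (e j)) -> nilpotent (e * (1 - e)) -> nilpotent e.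
Proof.
move=> en ee.
have [a ea] := laurent_bnd e; pose b := Num.min a 0.
have eb : lsupp_ge e b by apply: lsupp_geW ea; rewrite /b; lia.
pose n0 j := if j < 1 then e j else 0.
have n0L : n0 \in @laurent_pred R.
  by apply/asboolP; exists b => j jb; rewrite /n0; case: ifP => // _; apply: eb.
pose n := Laurent n0L; pose p := e - n.
have nn : nilpotent n.
  apply: (@nil_finite _ _ b (absz b).+1) => [j jb|j bj|j]; rewrite /= /n0.
  - by case: ifP => // _; apply: eb.
  - by case: ifP => // j1; move: bj j1; rewrite /b; lia.
  - by case: ifP => // _; apply: nil0.
have p1 : lsupp_ge (- p) 1.
  by move=> j j1; rewrite lcoefN lcoefB /= /n0 j1 subrr oppr0.
have [q [pq _]] := pos_inverse p1.
have [c ec] : invertible (1 - e).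
  rewrite (_ : 1 - e = 1 - p - n); last by rewrite /p; ring.
  by apply: invertible_nilD; [exists q|apply: nilN].
have := nilMr c ee; by rewrite -mulrA ec mulr1.
Qed.

(** Modulo each prime of the coefficients [e] is 0 or 1. So its coefficients off degree 0 are
    nilpotent and [e 0] is idempotent up to nilpotents; [pos_nil] returns from the coefficients to
    the series. *)
Lemma connected_laurent (R : comPzRingType) : connected_ring R -> connected_ring (laurent R).
Proof.
move=> Rc e een.
have Qe Q (QP : prime_ideal Q) : (forall j, Q (e j)) \/ (forall j, Q ((1 - e) j)).
  by apply: prime_lmul => // j; apply: prime_lnil.
have e0 j : j != 0 -> nilpotent (e j).
  move=> /negPf j0; apply: nil_primeP => Q QP; have [//|/(_ j)] := Qe Q QP.
  rewrite lcoefB lcoef1 j0 sub0r => /(idealN (prime_is_ideal QP)).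
  by rewrite opprK.
have : nilpotent (e 0 * (1 - e 0)).
  apply: nil_primeP => Q QP; have QI := prime_is_ideal QP.
  by have [/(_ 0)|/(_ 0)] := Qe Q QP; [apply: idealMr|apply: idealM].
case/Rc => [e00|e01]; [left|right].
  by apply: pos_nil => // j; have [->|/e0] := eqVneq j 0.
apply: pos_nil => [j|]; last by rewrite subKr mulrC.
have [->//|j0] := eqVneq j 0.
rewrite lcoefB lcoef1 (negPf j0) sub0r; exact/nilN/e0.
Qed.

(** Modulo each prime [f] starts in some degree between [a] and [- b], where [a] and [b] bound [f]
    and [g] from below. Connectedness makes this degree the same at all primes. *)
Lemma laurent_unit_lead (R : comPzRingType) (f g : laurent R) : connected_ring R ->
  f * g = 1 -> exists j, (forall i, i < j -> nilpotent (f i)) /\ invertible (f j).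
Proof.
move=> Rc fg.
have [a fa] := laurent_bnd f; have [b gb] := laurent_bnd g.
(* Modulo a prime Q of R, e p is 1 if f starts in a degree below a + p modulo Q((t)),
   and 0 otherwise; so e p is idempotent up to nilpotents. *)
pose e (p : nat) := \sum_(i < p) f (a + i%:Z) * g (- (a + i%:Z)).
have jQ (Q : set R) (QP : prime_ideal Q) : exists j,
    [/\ forall i, i < j -> Q (f i), forall i, i < - j -> Q (g i), Q (f j * g (- j) - 1),
        a <= j & j <= - b].
  have QI := prime_is_ideal QP; have Q0 := ideal0 QI.
  have Q1 : ~ Q 1 by apply: prime_ideal1 QP.
  have Qfg : ~ forall j, Q ((f * g) j) by rewrite fg => /(_ 0).
  have [|j [Qfj fj]] := lowest (f := f) Q0.
    move=> Qf; apply: Qfg => j; apply: (@lmul_lower _ Q f g (j + 1 - b) b) => //; last by lia.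
    by move=> i /gb ->.
  have [|k [Qgk gk]] := lowest (f := g) Q0.
    move=> Qg; apply: Qfg => i; apply: (@lmul_lower _ Q f g a (i + 1 - a)) => //; last by lia.
    by move=> l /fa ->.
  have low := lmul_low QI fj gk.
  have Qjk : ~ Q (f j * g k) by case/(prime_ideal_prime QP).
  have jk : k = - j.
    apply: contrapT => jk; apply: Qjk; move: low.
    rewrite fg lcoef1 ifF; last by lia.
    by rewrite sub0r => /(idealN QI); rewrite opprK.
  exists j; split=> //; rewrite -?jk//.
  - by move: low; rewrite fg lcoef1 ifT ?jk ?subrr// => /(idealN QI); rewrite opprB.
  - by rewrite leNgt; apply/negP => /fa e0; apply: Qfj; rewrite e0.
  - by rewrite leNgt; apply/negP => jb; apply: Qgk; rewrite gb//; lia.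
have eQ p (Q : set R) (QP : prime_ideal Q) j : 
    (forall i, i < j -> Q (f i)) -> (forall i, i < - j -> Q (g i)) -> a <= j ->
    Q (f j * g (- j) - 1) ->
    Q (e p - (if j < a + p%:Z then 1 else 0)).
  move=> fj gj aj fgj; have QI := prime_is_ideal QP.
  case: ifP => [jp|/negbT jp].
    have ltp : (absz (j - a) < p)%N by lia.
    rewrite /e (bigD1 (Ordinal ltp))//= (_ : a + _ = j); last by lia.
    rewrite addrAC; apply: idealD => //; apply: ideal_sum => // i /eqP ne.
    have [ij|ij] := ltP (a + i%:Z) j; first by apply: idealMr => //; apply: fj.
    apply: idealM => //; apply: gj.
    suff : a + i%:Z <> j by lia.
    by move=> e0; apply: ne; apply/val_inj => /=; lia.
  rewrite subr0; apply: ideal_sum => // i _; apply: idealMr => //; apply: fj.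
  by have := ltn_ord i; lia.
have idem p : nilpotent (e p * (1 - e p)).
  apply: nil_primeP => Q QP; have QI := prime_is_ideal QP.
  have [j [fj gj fgj aj _]] := jQ Q QP; have := eQ p Q QP j fj gj aj fgj.
  case: ifP => _ Qe; last by rewrite subr0 in Qe; apply: idealMr.
  by apply: idealM => //; rewrite -opprB; apply: idealN.
(* Beyond the window from [a] to [- b], [e p] is 1 at every prime. *)
have ex : exists p, `[< nilpotent (1 - e p) >].
  exists (absz (- b - a)%R).+1; apply/asboolP; apply: nil_primeP => Q QP.
  have QI := prime_is_ideal QP.
  have [j [fj gj fgj aj jb]] := jQ Q QP; have := eQ (absz (- b - a)%R).+1 Q QP j fj gj aj fgj.
  by rewrite ifT; [rewrite -opprB => /(idealN QI); rewrite opprK|lia].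
(* Since [e 0] is an empty sum, the minimum 0 occurs only in the zero ring. *)
case: (ex_minnP ex) => -[|p] /asboolP ep pmin.
  have [k] := ep; rewrite /e big_ord0 subr0 expr1n => R0.
  have nz (x : R) : x = 0 by rewrite -[x]mul1r R0 mul0r.
  by exists 0; split=> [i _|]; [rewrite (nz (f i)); apply: nil0|exists 0; rewrite (nz 1) (nz (_ * _))].
have ep' : nilpotent (e p).
  by have [//|/asboolP/pmin] := Rc _ (idem p); rewrite ltnn.
(* [e p] is 0 and [e p.+1] is 1 at every prime, so the starting degree is exactly [a + p]. *)
have jE (Q : set R) (QP : prime_ideal Q) :
    (forall i, i < a + p%:Z -> Q (f i)) /\ Q (f (a + p%:Z) * g (- (a + p%:Z)) - 1).
  have QI := prime_is_ideal QP; have Q1 : ~ Q 1 by apply: prime_ideal1 QP.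
  have [j [fj gj fgj aj jb]] := jQ Q QP.
  suff -> : a + p%:Z = j by [].
  have := eQ p Q QP j fj gj aj fgj; have := eQ p.+1 Q QP j fj gj aj fgj.
  have Qp := prime_nil QP ep; have Qp' := prime_nil QP ep'.
  case: ifP => [jp _|_]; last first.
    by rewrite subr0 => Qe _; case: Q1; rewrite -(subrK (e p.+1) 1); apply: idealD.
  case: ifP => [_ Qe|]; last by lia.
  by case: Q1; rewrite -(subKr (e p) 1); apply: idealB.
exists (a + p%:Z); split=> [i ip|].
  by apply: nil_primeP => Q QP; have [Qf _] := jE Q QP; apply: Qf.
apply: (@invertible_mull _ _ (g (- (a + p%:Z)))).
rewrite -[_ * _](subrK 1) addrC; apply: invertible1D.
by apply: nil_primeP => Q QP; have [] := jE Q QP.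
Qed.

(** * Leading exponents *)

(* f is invertible with leading exponent l. The part of f below t^l is required to be
   nilpotent in the ring of iterated series, which is more than having nilpotent
   coefficients. *)
Fixpoint lead (A : comPzRingType) n : 'cV[int]_n -> itlaurent A n -> Prop :=
  if n is n'.+1 return 'cV[int]_n -> itlaurent A n -> Prop then fun l f =>
    (forall j, j < l ord_max 0 -> nilpotent ((f : laurent _) j)) /\
    lead (row' ord_max l) ((f : laurent (itlaurent_ring A n')) (l ord_max 0))
  else fun _ f => @invertible A f.

Section Lead.
Variable A : comPzRingType.

Lemma leadS n (f : laurent (itlaurent_ring A n)) (l : 'cV[int]_n) j :
  lead (ccons l j) (f : itlaurent A n.+1) <->
  (forall i, i < j -> nilpotent (f i)) /\ lead l (f j : itlaurent A n).
Proof. by rewrite /= ccons_last ccons_row. Qed.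

Lemma nil_coef n (f : itlaurent A n) l : nilpotent f -> nilpotent (coef f l).
Proof.
elim: n f l => [//|n IHn] f l fn.
rewrite -(cconsK l) (@coefS A n); apply: IHn.
exact: (@nil_lcoef (itlaurent_ring A n)).
Qed.

Lemma lexleS n (l l' : 'cV[int]_n) j j' :
  lexle (ccons l j) (ccons l' j') = (j < j') || (j == j') && lexle l l'.
Proof. by rewrite /= !ccons_last !ccons_row. Qed.

Lemma lexltS n (l l' : 'cV[int]_n) j j' : lexlt (ccons l j) (ccons l' j') ->
  j < j' \/ j = j' /\ lexlt l l'.
Proof.
rewrite /lexlt lexleS => /andP[/orP[->|/andP[/eqP <- ll']] ne]; [by left|right].
by split=> //; rewrite ll' /=; apply: contra_neq ne => ->.
Qed.

(** Links [lead] with the conditions on coefficients in [has_valuation]. *)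
Lemma lead_coef n l (f : itlaurent A n) : lead l f ->
  (forall l', lexlt l' l -> nilpotent (coef f l')) /\ invertible (coef f l).
Proof.
elim: n l f => [|n IHn] l f.
  by move=> finv; split=> // l' /andP[_ /eqP[]]; apply/matrixP => -[].
rewrite -(cconsK l); move: (row' _ _) (l _ _) => {}l j.
move=> /(@leadS n f)[fj /IHn[fl finv]].
split=> [l'|]; last by rewrite (@coefS A n).
rewrite -(cconsK l') (@coefS A n) => /lexltS[/fj/(@nil_coef n)//|[-> /fl//]].
Qed.

Lemma lead_coef_neq0 n l (f : itlaurent A n) : (1 : A) != 0 -> lead l f -> coef f l <> 0.
Proof.
move=> /eqP A0 /lead_coef[_ finv] f0; apply: A0; apply: (invertible_nil finv).
by rewrite f0; apply: nil0.
Qed.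

Lemma lead_unique n l l' (f : itlaurent A n) :
  (1 : A) != 0 -> lead l f -> lead l' f -> l = l'.
Proof.
move=> /eqP A0 /lead_coef[fl finv] /lead_coef[fl' finv'].
apply: contrapT => /eqP ll'.
have /orP[lel|lel] := lexle_total l l'; apply: A0.
  by apply: (invertible_nil finv); apply: fl'; rewrite /lexlt lel.
by apply: (invertible_nil finv'); apply: fl; rewrite /lexlt lel eq_sym.
Qed.

Lemma lead_nilD n l (f h : itlaurent A n) : lead l f -> nilpotent h -> lead l (f + h).
Proof.
elim: n l f h => [|n IHn] l f h; first exact: invertible_nilD.
rewrite -(cconsK l); move: (row' _ _) (l _ _) => {}l j.
move=> /(@leadS n f)[fj flead] hn; apply/(@leadS n); split=> [i ij|].
  by apply: nilD; [exact: fj|exact: (@nil_lcoef (itlaurent_ring A n))].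
by apply: IHn => //; exact: (@nil_lcoef (itlaurent_ring A n)).
Qed.

(** This is [lmul_low] for the nilradical of the coefficient ring, followed by absorption of the
    nilpotent error through [lead_nilD]. *)
Lemma leadM n l l' (f g : itlaurent A n) : lead l f -> lead l' g -> lead (l + l') (f * g).
Proof.
elim: n l l' f g => [|n IHn] l l' f g; first exact: invertible_mul.
rewrite -(cconsK l) -(cconsK l') -cconsD.
move: (row' _ l) (l _ _) (row' _ l') (l' _ _) => {}l j {}l' j'.
move=> /(@leadS n f)[fj flead] /(@leadS n g)[gj glead]; apply/(@leadS n).
have nI := nil_ideal (itlaurent_ring A n).
split=> [i ij|]; first exact: (@lmul_lower (itlaurent_ring A n) _ f g j j').
have low := @lmul_low (itlaurent_ring A n) _ f g j j' nI fj gj.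
have := lead_nilD (IHn l l' _ _ flead glead) low.
by rewrite [X in lead _ X]addrC subrK.
Qed.

Lemma lead_mono n (l : 'cV[int]_n) : lead l (mono A l).
Proof.
elim: n l => [|n IHn] l; first by exists 1; rewrite mulr1.
split=> [j jl|] /=; first by rewrite lt_eqF//; apply: nil0.
by rewrite eqxx.
Qed.

Lemma lcoefZ n a (f : itlaurent A n.+1) j :
  ((a *: f : itlaurent A n.+1) : laurent _) j = a *: ((f : laurent _) j : itlaurent A n).
Proof. exact: (@lconst_coefM (itlaurent_ring A n)). Qed.

(** Below the leading exponent the deformation only multiplies nilpotents by [a]; at the leading
    exponent the coefficient c becomes 1 + a (c - 1). *)
Lemma lead_deform n l (f : itlaurent A n) a : lead l f ->
  invertible (1 + a * (coef f l - 1)) -> lead l (mono A l + a *: (f - mono A l)).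
Proof.
elim: n l f => [|n IHn] l f; first by [].
rewrite -(cconsK l); move: (row' _ _) (l _ _) => {}l j.
move=> /(@leadS n f)[fj flead]; rewrite (@coefS A n) => finv; apply/(@leadS n).
have monoE i : (mono A (ccons l j) : laurent _) i = if i == j then mono A l else 0.
  by rewrite /= ccons_last ccons_row.
split=> [i ij|].
  rewrite lcoefD lcoefZ lcoefB monoE lt_eqF// add0r subr0.
  by apply: nilM; apply: fj.
by rewrite lcoefD lcoefZ lcoefB monoE eqxx; exact: (IHn l ((f : laurent _) j)).
Qed.

Lemma lead_unit n (f g : itlaurent A n) : connected_ring A -> f * g = 1 ->
  exists l, lead l f.
Proof.
move=> Ac; have Lc k : connected_ring (itlaurent_ring A k).
  by elim: k => [//|k IHk]; exact: connected_laurent.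
elim: n f g => [f g fg|n IHn f g]; first by exists 0, g.
move=> /(@laurent_unit_lead (itlaurent_ring A n) f g (Lc n))[j [fj [h fh]]].
have [l fl] := IHn ((f : laurent _) j) h fh.
by exists (ccons l j); apply/(@leadS n).
Qed.

End Lead.

Lemma lead_map (A B : comPzRingType) (g : {rmorphism A -> B}) n l (f : itlaurent A n) :
  lead l f -> lead l (itmap g n f).
Proof.
elim: n l f => [|n IHn] l f; first exact: invertible_map.
by move=> [fj flead]; split=> [j /fj|]; [exact: nil_map|exact: IHn].
Qed.

(** * Units all of whose integer powers have supports in a common bounded set *)

Section BoundedUnits.
Variables (A : comPzRingType) (n : nat).
Implicit Types (E : set 'cV[int]_n) (f g h x : itlaurent A n).

Definition pow_in E f := forall k, supp (f ^+ k) `<=` E.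

(** The inverse is carried along because powers with negative exponents occur as well. *)
Definition bunit f g := [/\ f * g = 1, exists2 E, bnd E & pow_in E f &
  exists2 E, bnd E & pow_in E g].

Lemma supp_sum (I : Type) (r : seq I) (P : pred I) (F : I -> itlaurent A n) E :
  (forall i, P i -> supp (F i) `<=` E) -> supp (\sum_(i <- r | P i) F i) `<=` E.
Proof.
move=> FE l; rewrite /supp /= coef_sum; apply: contraNP => lE.
apply/eqP/big1 => i Pi; apply: contrapT => /eqP Fl; apply: lE; exact: FE Fl.
Qed.

Lemma suppZn (x : itlaurent A n) k : supp (x *+ k) `<=` supp x.
Proof.
move=> l; rewrite /supp /= -scaler_nat coefZ.
by apply: contra => /eqP ->; rewrite mulr0.
Qed.

Lemma pow_in1D x : pow_in (\bigcup_(i in [set: nat]) supp (x ^+ i)) (1 + x).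
Proof.
move=> k; rewrite addrC exprDn; apply: supp_sum => i _.
rewrite expr1n mulr1 => l /suppZn xl; by exists (k - i)%N.
Qed.

Lemma bnd_nil_pow x : nilpotent x -> bnd (\bigcup_(i in [set: nat]) supp (x ^+ i)).
Proof.
move=> [k xk].
have := @bnd_bigU _ _ `I_k (fun i => supp (x ^+ i)) (finite_II k) (fun i _ => supp_bnd _).
apply: bndW => l [i _ il]; exists i => //=; rewrite ltnNge; apply/negP => ki.
by move: il; rewrite -(subnK ki) exprD xk mulr0 /supp /= coef0 eqxx.
Qed.

(** The inverse has the same shape as the unit: [g = 1 + (- x * g)] with [- x * g] nilpotent. *)
Lemma bunit_nil x g : nilpotent x -> (1 + x) * g = 1 -> bunit (1 + x) g.
Proof.
move=> xn xg; split=> //.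
  by exists (\bigcup_(i in [set: nat]) supp (x ^+ i)); [exact: bnd_nil_pow|exact: pow_in1D].
have -> : g = 1 + (- x * g) by rewrite -[X in X + _]xg; ring.
exists (\bigcup_(i in [set: nat]) supp ((- x * g) ^+ i)); last exact: pow_in1D.
by apply: bnd_nil_pow; apply: nilMr; apply: nilN.
Qed.

Lemma bunitM f g f' g' : bunit f g -> bunit f' g' -> bunit (f * f') (g * g').
Proof.
move=> [fg [E Eb fE] [F Fb gF]] [fg' [E' Eb' fE'] [F' Fb' gF']]; split.
- by rewrite mulrACA fg fg' mulr1.
- exists [set l + l' | l in E & l' in E']; first exact: bnd_sum.
  move=> k l; rewrite exprMn => /suppM[l1 /fE El1 [l2 /fE' El2 <-]].
  by exists l1 => //; exists l2.
- exists [set l + l' | l in F & l' in F']; first exact: bnd_sum.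
  move=> k l; rewrite exprMn => /suppM[l1 /gF El1 [l2 /gF' El2 <-]].
  by exists l1 => //; exists l2.
Qed.

End BoundedUnits.

Section BoundedUnitsS.
Variables (A : comPzRingType) (n : nat).
Local Notation R := (itlaurent_ring A n).

Lemma bunit_const (f g : itlaurent A n) : bunit f g ->
  bunit (lconst (f : R) : itlaurent A n.+1) (lconst (g : R) : itlaurent A n.+1).
Proof.
have suppC E (h : itlaurent A n) : pow_in E h ->
    pow_in [set ccons l 0 | l in E] (lconst (h : R) : itlaurent A n.+1).
  move=> hE k l; rewrite -(@rmorphXn R (laurent R) (@lconst R)) /supp /=.
  rewrite -(cconsK l) (@coefS A n) /=; case: (l ord_max 0 =P 0) => [l0|_]; last by rewrite (coef0 A) eqxx.
  by move=> /hE lE; exists (row' ord_max l) => //; rewrite l0.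
have bndC E : bnd E -> bnd [set ccons l 0 | l in E] :> Prop.
  move=> Eb; apply/bndS; split=> [|j]; first by exists 0 => _ [l _ <-]; rewrite ccons_last.
  by apply: bndW Eb => l [l' El' /ccons_eq[<-]].
move=> [fg [E Eb fE] [F Fb gF]]; split.
- by rewrite -(@rmorphM R (laurent R) (@lconst R)) -(@rmorph1 R (laurent R) (@lconst R)); congr lconst.
- by exists [set ccons l 0 | l in E]; [exact: bndC|exact: suppC].
- by exists [set ccons l 0 | l in F]; [exact: bndC|exact: suppC].
Qed.

(** [x ^+ i] starts in degree [i] of the last variable, so only finitely many powers reach a given
    slice. *)
Lemma bnd_pos_pow (x : itlaurent A n.+1) : lsupp_ge (x : laurent R) 1 ->
  bnd (\bigcup_(i in [set: nat]) supp (x ^+ i)).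
Proof.
move=> x1.
have xi i : lsupp_ge ((x : laurent R) ^+ i) i%:Z.
  elim: i => [|i IHi]; first exact: lmonom_supp.
  by rewrite exprS => k ki; apply: (lsuppM x1 IHi); lia.
apply/bndS; split=> [|j].
  exists 0 => l [i _]; rewrite -(cconsK l) ccons_last leNgt /supp /= (@coefS A n).
  apply: contraNN => l0; rewrite (xi i); first by rewrite (coef0 A).
  by apply: lt_le_trans l0 _.
have := @bnd_bigU _ _ `I_(absz j).+1 (fun i => slice (supp (x ^+ i)) j)
  (finite_II _) (fun i _ => (iffLR (bndS _) (supp_bnd _)).2 j).
apply: bndW => l [i _ il]; exists i => //=; rewrite ltnNge; apply/negP => ji.
move: il; rewrite /supp /= (@coefS A n) (xi i) ?(coef0 A) ?eqxx//; lia.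
Qed.

Lemma bunit_pos (x g : itlaurent A n.+1) :
  lsupp_ge (x : laurent R) 1 -> lsupp_ge (g : laurent R) 0 -> (1 + x) * g = 1 ->
  bunit (1 + x) g.
Proof.
move=> x1 g0 xg; split=> //.
  by exists (\bigcup_(i in [set: nat]) supp (x ^+ i)); [exact: bnd_pos_pow|exact: pow_in1D].
have -> : g = 1 + (- x * g) by rewrite -[X in X + _]xg; ring.
exists (\bigcup_(i in [set: nat]) supp ((- x * g) ^+ i)); last exact: pow_in1D.
apply: bnd_pos_pow => i i1; rewrite mulNr lcoefN.
by rewrite (lsuppM x1 g0) ?oppr0.
Qed.

End BoundedUnitsS.

Lemma bunit0 (A : comPzRingType) (f g : itlaurent A 0) : f * g = 1 -> bunit f g.
Proof. by move=> fg; split=> //; exists setT => //; exists tt. Qed.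

(* f = t^l c (1 + p)(1 + n), with c a unit of the coefficient ring, p of positive
   degree in the last variable, and n nilpotent. *)
Lemma lead_bunit (A : comPzRingType) n l (f : itlaurent A n) : lead l f ->
  exists g h, f = mono A l * g /\ bunit g h.
Proof.
elim: n l f => [|n IHn] l f.
  by move=> [g fg]; exists f, g; split; [rewrite mul1r|exact: bunit0].
rewrite -(cconsK l); move: (row' _ _) (l _ _) => {}l j.
move=> /(@leadS A n f)[fj /IHn[g0 [h0 [fjE gh0]]]].
pose R := itlaurent_ring A n.
have [gh0E _ _] := gh0.
(* [c] is the inverse of the coefficient of [f] in degree [j]; multiplying by it and shifting by
   [- j] gives [f1], with coefficient 1 in degree 0 and nilpotent coefficients below. *)
pose c : R := mono A (- l) * h0.
have fjc : (f : laurent R) j * c = 1.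
  rewrite fjE /c [LHS](_ : _ = (mono A l * mono A (- l)) * (g0 * h0)); last first.
    by rewrite mulrACA.
  by rewrite -monoD subrr mono0 gh0E mulr1.
pose f1 : laurent R := lmonom c (- j) * (f : laurent R).
have f1E i : f1 i = c * (f : laurent R) (i + j).
  have [a fa] := laurent_bnd (f : laurent R).
  rewrite (lcoefME (n := (absz (i + j - a)%R).+1) (@lmonom_supp R c (- j)) fa); last by lia.
  rewrite big_ord_recl big1 ?addr0 => [|k _]; last first.
    by rewrite /= (_ : _ == - j = false) ?mul0r//; rewrite /bump /=; lia.
  rewrite /= (_ : (_ == - j) = true); last by lia.
  by congr (_ * (f : laurent R) _); lia.
have f10 : f1 0 = 1 by rewrite f1E add0r mulrC.
have f1n i : i < 0 -> nilpotent (f1 i).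
  by move=> i0; rewrite f1E; apply: nilM; apply: fj; lia.
have [a fa] := laurent_bnd f1; pose b := Num.min a 0.
have fb : lsupp_ge f1 b by apply: lsupp_geW fa; rewrite /b; lia.
pose n0 i := if i < 0 then f1 i else 0.
have n0L : n0 \in @laurent_pred R.
  by apply/asboolP; exists b => i ib; rewrite /n0; case: ifP => // _; apply: fb.
pose nf := Laurent n0L; pose p := f1 - 1 - nf.
have nn : nilpotent nf.
  apply: (@nil_finite _ _ b (absz b)) => [i ib|i bi|i]; rewrite /= /n0.
  - by case: ifP => // _; apply: fb.
  - by case: ifP => // i1; move: bi i1; rewrite /b; lia.
  - by case: ifP => [/f1n//|_]; apply: nil0.
have p1 : lsupp_ge p 1.
  move=> i i1; rewrite !lcoefB lcoef1 -[nf i]/(n0 i) /n0.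
  have [i0|i0] := ltP i 0; first by rewrite lt_eqF// subr0 subrr.
  have -> : i = 0 by lia.
  by rewrite f10 subrr subr0.
have [q [pq q0]] := pos_inverse p1.
have qn : nilpotent (q * nf) by apply: nilM.
have [h1 qh1] := invertible1D qn.
(* [f1] is [1 + p + nf], and [q] is the inverse of [1 + p]. *)
have f1prod : f1 = (1 + p) * (1 + q * nf).
  by rewrite mulrDr mulrA pq mul1r mulr1 /p; ring.
exists (lconst (g0 : R) * ((1 + p) * (1 + q * nf)) : laurent R).
exists (lconst (h0 : R) * (q * h1) : laurent R); split; last first.
  apply: (@bunitM A n.+1); first exact: bunit_const.
  by apply: (@bunitM A n.+1); [exact: bunit_pos|exact: bunit_nil].
rewrite -f1prod.
have monoE : (mono A (ccons l j) : laurent R) = lmonom (mono A l : R) j.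
  by rewrite /= ccons_last ccons_row.
transitivity ((mono A (ccons l j) : laurent R) * (lconst (g0 : R) * f1)); last by [].
rewrite monoE mulrA lmonomM addr0 /f1 mulrA lmonomM subrr.
rewrite [X in lmonom X 0](_ : _ = 1); last by rewrite -fjc fjE.
by rewrite mul1r.
Qed.

(** * Homomorphisms with prescribed leading exponents *)

Section IntegerPowers.
Variables (R : comPzRingType) (g h : R).

Definition zpow (z : int) : R :=
  match z with Posz k => g ^+ k | Negz k => h ^+ k.+1 end.

Hypothesis gh : g * h = 1.

(** Every presentation of [z] as a difference gives the same value, which spares a discussion of
    signs in [zpowD]. *)
Lemma zpowE (z : int) (a b : nat) : z = a%:Z - b%:Z -> zpow z = g ^+ a * h ^+ b.
Proof.
have ghX k : g ^+ k * h ^+ k = 1 by rewrite -exprMn gh expr1n.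
case: z => k /= e.
  have -> : a = (k + b)%N by lia.
  by rewrite exprD -mulrA ghX mulr1.
have -> : b = (a + k.+1)%N by lia.
by rewrite exprD mulrA ghX mul1r.
Qed.

Lemma zpowD (z z' : int) : zpow (z + z') = zpow z * zpow z'.
Proof.
have dec (y : int) : exists a b : nat, y = a%:Z - b%:Z.
  by case: y => k; [exists k, 0%N|exists 0%N, k.+1]; lia.
have [a [b zE]] := dec z; have [c [d zE']] := dec z'.
rewrite (zpowE zE) (zpowE zE') (@zpowE _ (a + c) (b + d)); last by lia.
by rewrite !exprD mulrACA.
Qed.

End IntegerPowers.

(** For additive [kappa], this is summability of the monomials with exponents [kappa l], stated
    without reference to a ring. *)
Definition proper_exponents n m (kappa : 'cV[int]_n -> 'cV[int]_m) :=
  forall F, bnd F -> bnd [set l | F (kappa l)].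

Section Family.
Variables (A : comPzRingType) (n m : nat).
Variables (kappa : {additive 'cV[int]_n -> 'cV[int]_m}).

Lemma supp_prod_zpow (g h : 'I_n -> itlaurent A m) (r : seq 'I_n) :
  (forall i, bunit (g i) (h i)) -> exists2 E, bnd E &
    forall l : 'cV[int]_n, supp (\prod_(i <- r) zpow (g i) (h i) (l i 0)) `<=` E.
Proof.
move=> gh; elim: r => [|i r [E Eb rE]].
  exists [set 0]; first exact: bnd1.
  by move=> l; rewrite big_nil -(mono0 A m); exact: supp_mono.
have [_ [F Fb gF] [G Gb hG]] := gh i.
exists [set l + l' | l in F `|` G & l' in E]; first by apply: bnd_sum => //; apply: bndU.
move=> l; rewrite big_cons => k /suppM[l1 l1P [l2 /rE El2 <-]].
exists l1; last by exists l2.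
by move: l1P; rewrite /zpow; case: (l i 0) => j; [move=> /gF|move=> /hG]; [left|right].
Qed.

(** The image of t^l is t^(kappa l) times [gamma l], and all [gamma l] have their supports in one
    bounded set [E]. Properness applied to the sum of [F] and [E] gives summability. *)
Theorem hom_of_leads (u : 'I_n -> itlaurent A m) : proper_exponents kappa ->
  (forall i, lead (kappa (delta_mx i 0)) (u i)) ->
  exists phi : calgHom A n m, forall i, phi (tvar A i) = u i.
Proof.
move=> kP uk.
have /choice[g /choice[h gh]] := fun i => lead_bunit (uk i).
have ghE i : g i * h i = 1 by have [_ []] := gh i.
pose gamma (l : 'cV[int]_n) := \prod_i zpow (g i) (h i) (l i 0).
have [E Eb gE] := @supp_prod_zpow g h (index_enum _) (fun i => (gh i).2).
have gammaD l l' : gamma (l + l') = gamma l * gamma l'.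
  by rewrite /gamma -big_split; apply: eq_bigr => i _; rewrite mxE zpowD.
have gamma0 : gamma 0 = 1 by rewrite /gamma big1// => i _; rewrite mxE.
pose X l := mono A (kappa l) * gamma l.
have X0 : X 0 = 1 by rewrite /X raddf0 mono0 gamma0 mulr1.
have XD l l' : X (l + l') = X l * X l'.
  by rewrite /X raddfD monoD gammaD mulrACA.
have Xs : summable X.
  move=> F Fb; apply: bndW (kP _ (bnd_sum Fb Eb)) => l [k Fk].
  rewrite /X coef_monoM => /eqP /gE Ek; exists k => //; exists (- k - kappa (- l)) => //.
  by rewrite raddfN opprK addNKr.
have [phi phiP] := hom_of_family Xs XD X0.
exists phi => i; rewrite tvar_mono phiP /X; have [-> _] := gh i; congr (_ * _).
rewrite /gamma (bigD1 i)//= big1 => [|j /negPf ji]; last by rewrite mxE ji.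
by rewrite mxE !eqxx /= expr1 mulr1.
Qed.

End Family.

(** * Localizations of quotients *)

(** Quotients (denominators {1}) and localizations (ideal 0) are both instances, so one construction
    serves for [trunc], for the connected quotient and for the deformation ring. *)
Record loc_data (R : comPzRingType) := LocData {
  loc_den : set R;
  loc_ideal : set R;
  loc_den1 : loc_den 1;
  loc_denM : forall s t, loc_den s -> loc_den t -> loc_den (s * t);
  loc_idealP : is_ideal loc_ideal
}.

(* S^-1 (R / I) for a multiplicative subset S and an ideal I of R *)
Section Localization.
Variables (R : comPzRingType) (d : loc_data R).
Local Notation S := (loc_den d).
Local Notation I := (loc_ideal d).

Definition frac_pre := (R * {s : R | `[< S s >]})%type.
HB.instance Definition _ := Choice.on frac_pre.

Definition den_mul (s t : {s : R | `[< S s >]}) : {s : R | `[< S s >]} :=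
  exist _ (val s * val t) (asboolT (loc_denM (asboolW (valP s)) (asboolW (valP t)))).
Definition den1 : {s : R | `[< S s >]} := exist _ 1 (asboolT (loc_den1 d)).

Definition frac_rel (x y : frac_pre) : bool :=
  `[< exists v, S v /\ I (v * (x.1 * val y.2 - y.1 * val x.2)) >].

Lemma frac_refl : reflexive frac_rel.
Proof.
move=> x; apply/asboolP; exists 1; split; first exact: loc_den1.
by rewrite subrr mulr0; apply: ideal0; apply: loc_idealP.
Qed.

Lemma frac_sym : symmetric frac_rel.
Proof.
suff sub x y : frac_rel x y -> frac_rel y x by move=> x y; apply/idP/idP; apply: sub.
move=> /asboolP[v [Sv Iv]]; apply/asboolP; exists v; split=> //.
by rewrite -opprB mulrN; apply: idealN => //; apply: loc_idealP.
Qed.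

Lemma frac_trans : transitive frac_rel.
Proof.
move=> [b t] [a s] [c u] /asboolP[v [Sv Iv]] /asboolP[w [Sw Iw]]; apply/asboolP.
have St : S (val t) := asboolW (valP t).
exists (v * w * val t); split; first by do 2!apply: loc_denM => //.
have IP := loc_idealP d.
rewrite /= in Iv Iw *.
have -> : v * w * val t * (a * val u - c * val s) =
  (w * val u) * (v * (a * val t - b * val s)) + (v * val s) * (w * (b * val u - c * val t)).
  by ring.
by apply: (idealD IP); apply: (idealM IP).
Qed.

Canonical frac_equiv := EquivRel frac_rel frac_refl frac_sym frac_trans.

Definition loc := {eq_quot frac_equiv}.
HB.instance Definition _ := Choice.on loc.

Definition frac (a : R) (s : {s : R | `[< S s >]}) : loc := \pi_loc (a, s).

Lemma frac_ind (P : loc -> Prop) : (forall a s, P (frac a s)) -> forall x, P x.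
Proof. by move=> Pf x; rewrite -[x]reprK; case: (repr x) => a s; apply: Pf. Qed.

Lemma frac_eqP a s b t : frac a s = frac b t <->
  exists v, S v /\ I (v * (a * val t - b * val s)).
Proof. by split=> [/eqmodP/asboolP|H]; last by apply/eqmodP/asboolP. Qed.

Lemma frac_eq a s b t : a * val t = b * val s -> frac a s = frac b t.
Proof.
move=> e; apply/frac_eqP; exists 1; split; first exact: loc_den1.
by rewrite e subrr mulr0; apply: ideal0; apply: loc_idealP.
Qed.

Definition loc_op (f : frac_pre -> frac_pre -> frac_pre) (x y : loc) : loc :=
  \pi_loc (f (repr x) (repr y)).

Lemma repr_frac a s : exists v, S v /\
  I (v * ((repr (frac a s)).1 * val s - a * val (repr (frac a s)).2)).
Proof.
have : frac (repr (frac a s)).1 (repr (frac a s)).2 = frac a s.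
  by rewrite /frac -surjective_pairing reprK.
by move/frac_eqP.
Qed.

Definition loc_add := loc_op (fun x y =>
  (x.1 * val y.2 + y.1 * val x.2, den_mul x.2 y.2)).
Definition loc_mul := loc_op (fun x y => (x.1 * y.1, den_mul x.2 y.2)).
Definition loc_opp (x : loc) : loc := \pi_loc (- (repr x).1, (repr x).2).

Lemma loc_addE a s b t :
  loc_add (frac a s) (frac b t) = frac (a * val t + b * val s) (den_mul s t).
Proof.
have [v [Sv Iv]] := repr_frac a s; have [w [Sw Iw]] := repr_frac b t.
apply/frac_eqP; exists (v * w); split; first exact: loc_denM.
move: (repr (frac a s)) (repr (frac b t)) Iv Iw => [a' s'] [b' t'] /= Iv Iw.
have IP := loc_idealP d.
have -> : v * w * ((a' * val t' + b' * val s') * (val s * val t) -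
    (a * val t + b * val s) * (val s' * val t')) =
  (w * val t * val t') * (v * (a' * val s - a * val s')) +
  (v * val s * val s') * (w * (b' * val t - b * val t')) by ring.
by apply: (idealD IP); apply: (idealM IP).
Qed.

Lemma loc_mulE a s b t : loc_mul (frac a s) (frac b t) = frac (a * b) (den_mul s t).
Proof.
have [v [Sv Iv]] := repr_frac a s; have [w [Sw Iw]] := repr_frac b t.
apply/frac_eqP; exists (v * w); split; first exact: loc_denM.
move: (repr (frac a s)) (repr (frac b t)) Iv Iw => [a' s'] [b' t'] /= Iv Iw.
have IP := loc_idealP d.
have -> : v * w * (a' * b' * (val s * val t) - a * b * (val s' * val t')) =
  (w * b' * val t) * (v * (a' * val s - a * val s')) +
  (v * a * val s') * (w * (b' * val t - b * val t')) by ring.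
by apply: (idealD IP); apply: (idealM IP).
Qed.

Lemma loc_oppE a s : loc_opp (frac a s) = frac (- a) s.
Proof.
have [v [Sv Iv]] := repr_frac a s.
apply/frac_eqP; exists v; split => //.
move: (repr (frac a s)) Iv => [a' s'] /= Iv.
rewrite !mulNr opprK addrC -opprB mulrN; apply: idealN => //; exact: loc_idealP.
Qed.

Let loc_addA : associative loc_add.
Proof.
move=> x y z; elim/frac_ind: x => a s; elim/frac_ind: y => b t; elim/frac_ind: z => c u.
by rewrite !loc_addE; apply: frac_eq => /=; ring.
Qed.
Let loc_addC : commutative loc_add.
Proof.
move=> x y; elim/frac_ind: x => a s; elim/frac_ind: y => b t.
by rewrite !loc_addE; apply: frac_eq => /=; ring.
Qed.
Let loc_add0 : left_id (frac 0 den1) loc_add.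
Proof.
move=> x; elim/frac_ind: x => a s.
by rewrite !loc_addE; apply: frac_eq => /=; ring.
Qed.
Let loc_addN : left_inverse (frac 0 den1) loc_opp loc_add.
Proof.
move=> x; elim/frac_ind: x => a s.
by rewrite !loc_oppE loc_addE; apply: frac_eq => /=; ring.
Qed.

HB.instance Definition _ := GRing.isZmodule.Build loc loc_addA loc_addC loc_add0 loc_addN.

Let loc_mulA : associative loc_mul.
Proof.
move=> x y z; elim/frac_ind: x => a s; elim/frac_ind: y => b t; elim/frac_ind: z => c u.
by rewrite !loc_mulE; apply: frac_eq => /=; ring.
Qed.
Let loc_mulC : commutative loc_mul.
Proof.
move=> x y; elim/frac_ind: x => a s; elim/frac_ind: y => b t.
by rewrite !loc_mulE; apply: frac_eq => /=; ring.
Qed.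
Let loc_mul1 : left_id (frac 1 den1) loc_mul.
Proof.
move=> x; elim/frac_ind: x => a s.
by rewrite !loc_mulE; apply: frac_eq => /=; ring.
Qed.
Let loc_mulDl : left_distributive loc_mul +%R.
Proof.
move=> x y z; elim/frac_ind: x => a s; elim/frac_ind: y => b t; elim/frac_ind: z => c u.
rewrite [LHS](_ : _ = loc_mul (loc_add (frac a s) (frac b t)) (frac c u))//.
rewrite [RHS](_ : _ = loc_add (loc_mul (frac a s) (frac c u)) (loc_mul (frac b t) (frac c u)))//.
by rewrite !(loc_addE, loc_mulE); apply: frac_eq => /=; ring.
Qed.

HB.instance Definition _ :=
  GRing.Zmodule_isComPzRing.Build loc loc_mulA loc_mulC loc_mul1 loc_mulDl.

Definition loc_in (a : R) : loc := frac a den1.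

Lemma loc_in_zmod : zmod_morphism loc_in.
Proof.
move=> a b; rewrite [RHS](_ : _ = loc_add (frac a den1) (loc_opp (frac b den1)))//.
by rewrite loc_oppE loc_addE; apply: frac_eq => /=; ring.
Qed.

Lemma loc_in_monoid : monoid_morphism loc_in.
Proof.
split=> // a b; rewrite [RHS](_ : _ = loc_mul (frac a den1) (frac b den1))//.
by rewrite loc_mulE; apply: frac_eq => /=; ring.
Qed.

HB.instance Definition _ := GRing.isZmodMorphism.Build R loc loc_in loc_in_zmod.
HB.instance Definition _ := GRing.isMonoidMorphism.Build R loc loc_in loc_in_monoid.

Lemma loc_in_den s : S s -> invertible (loc_in s).
Proof.
move=> Ss; exists (frac 1 (exist _ s (asboolT Ss))).
rewrite [LHS](_ : _ = loc_mul (frac s den1) (frac 1 (exist _ s (asboolT Ss))))//.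
by rewrite loc_mulE; apply: frac_eq => /=; ring.
Qed.

Lemma loc_ex (x : loc) : exists a s, S s /\ x * loc_in s = loc_in a.
Proof.
elim/frac_ind: x => a s; exists a, (val s); split; first exact: asboolW (valP s).
rewrite [LHS](_ : _ = loc_mul (frac a s) (frac (val s) den1))//.
by rewrite loc_mulE; apply: frac_eq => /=; ring.
Qed.

Lemma loc_in_eq0 a : loc_in a = 0 <-> exists v, S v /\ I (v * a).
Proof.
rewrite (_ : 0 = frac 0 den1)//.
split=> [/frac_eqP|] [v [Sv Iv]]; [|apply/frac_eqP]; exists v; split=> //.
  by rewrite mul0r subr0 mulr1 in Iv.
by rewrite mul0r subr0 mulr1.
Qed.

Lemma loc_lift (T : comPzRingType) (f : {rmorphism R -> T}) :
  (forall s, S s -> invertible (f s)) -> (forall a, I a -> f a = 0) ->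
  exists F : {rmorphism loc -> T}, forall a, F (loc_in a) = f a.
Proof.
move=> fS fI.
have inv_inj (x y z : T) : invertible x -> y * x = z * x -> y = z.
  by move=> [x' xx'] e; rewrite -[y]mulr1 -[z]mulr1 -xx' !mulrA e.
have in_eq a b : loc_in a = loc_in b -> f a = f b.
  move=> /eqP; rewrite -subr_eq0 -rmorphB => /eqP/loc_in_eq0[v [Sv Iv]].
  apply/eqP; rewrite -subr_eq0 -rmorphB; apply/eqP; apply: (inv_inj _ _ _ (fS v Sv)).
  by rewrite mul0r -rmorphM mulrC; apply: fI.
(* The value at [x] is pinned down by all presentations of [x] at once, so later identities can be
   checked on any presentation. *)
have /choice[F FP] : forall x : loc, exists y, forall a s, S s ->
    x * loc_in s = loc_in a -> y * f s = f a.
  move=> x; have [a [s [Ss xs]]] := loc_ex x; have [t st] := fS s Ss.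
  exists (f a * t) => b u Su xu; rewrite mulrAC.
  have -> : f a * f u = f b * f s.
    rewrite -!rmorphM; apply: in_eq; rewrite [LHS]rmorphM [RHS]rmorphM. rewrite /= -xs -xu.
    by rewrite mulrAC.
  by rewrite -mulrA st mulr1.
have FB : zmod_morphism F.
  move=> x y; have [a [s [Ss xs]]] := loc_ex x; have [b [t [St yt]]] := loc_ex y.
  apply: (inv_inj (f (s * t)) _ _ (fS _ (loc_denM Ss St))).
  rewrite (FP (x - y) (a * t - b * s) (s * t)); first last.
  - by rewrite !(rmorphB, rmorphM) /= mulrBl -xs -yt; ring.
  - exact: loc_denM.
  by rewrite !(rmorphB, rmorphM) mulrBl -(FP _ _ _ Ss xs) -(FP _ _ _ St yt); ring.
have FM : monoid_morphism F.
  split=> [|x y].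
    by have := FP 1 1 1 (loc_den1 d) (mul1r _); rewrite rmorph1 mulr1.
  have [a [s [Ss xs]]] := loc_ex x; have [b [t [St yt]]] := loc_ex y.
  apply: (inv_inj (f (s * t)) _ _ (fS _ (loc_denM Ss St))).
  rewrite (FP (x * y) (a * b) (s * t)); first last.
  - by rewrite !rmorphM /= -xs -yt; ring.
  - exact: loc_denM.
  by rewrite !rmorphM -(FP _ _ _ Ss xs) -(FP _ _ _ St yt); ring.
have [G GF] := rmorphism_pack FB FM; exists G => a.
have := FP (loc_in a) a 1 (loc_den1 d); rewrite !rmorph1 !mulr1 => /(_ erefl).
by rewrite GF.
Qed.

End Localization.

(** * The deformation ring *)

(** [{poly A}] is formed over a nonzero ring, so the zero ring is treated apart; the equality allows
    the given ring to be replaced. *)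
Lemma nz_ring (A : comPzRingType) : (1 : A) != 0 ->
  exists B : comNzRingType, (B : comPzRingType) = A.
Proof.
move=> A0; pose m := GRing.PzSemiRing_isNonZero.Build A A0.
by exists (HB.pack_for comNzRingType A m); case: A A0 @m => T [].
Qed.

Lemma loc_data_quotient (R : comPzRingType) (I : set R) : is_ideal I ->
  exists d : loc_data R, loc_den d = [set 1] /\ loc_ideal d = I.
Proof.
move=> II; have M (s t : R) : [set 1] s -> [set 1] t -> [set (1 : R)] (s * t).
  by move=> -> ->; rewrite /= mulr1.
by exists (@LocData R [set 1] I erefl M II).
Qed.

(** Suppose b^N (1 - b)^N lies in [I] but neither factor does. By maximality [a] is in I + (b^N) and
    in I + ((1 - b)^N), so both powers multiply [a] into [I]. Then so does (b + (1 - b))^(2N) = 1, a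
    contradiction. *)
Lemma connected_quotient (A : comPzRingType) (a : A) : a != 0 ->
  exists (B : comPzRingType) (g : {rmorphism A -> B}), g a != 0 /\ connected_ring B.
Proof.
move=> /eqP a0; have [|I [II Ia Imax]] := @maximal_avoiding A [set a].
  by move=> /esym.
have {Imax} Imax x : ~ I x -> exists i r, I i /\ i + r * x = a by move=> /Imax.
have [d [dS dI]] := loc_data_quotient II.
have in0 x : @loc_in A d x = 0 <-> I x.
  split=> [/loc_in_eq0[v]|Ix]; first by rewrite dS dI => -[-> ]; rewrite mul1r.
  by apply/loc_in_eq0; exists 1; rewrite dS dI mul1r.
exists (loc d), (@loc_in A d); split; first by apply/eqP => /in0; apply: Ia.
move=> e; have [b [s [Ss ebs]]] := loc_ex e.
have {s Ss ebs} -> : e = loc_in d b.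
  by move: Ss ebs; rewrite dS => ->; rewrite rmorph1 mulr1.
rewrite -(rmorph1 (@loc_in A d)) -rmorphB -rmorphM => -[N].
rewrite -rmorphXn => /in0; rewrite exprMn => Ibc.
have [bN|bN] := pselect (I (b ^+ N)).
  by left; exists N; rewrite -rmorphXn; apply/in0.
have [cN|cN] := pselect (I ((1 - b) ^+ N)).
  by right; exists N; rewrite -rmorphXn; apply/in0.
have bca : I (b ^+ N * a).
  have [i [r [Ii <-]]] := Imax _ cN; rewrite mulrDr; apply: (idealD II).
    exact: idealM.
  by rewrite mulrCA; apply: idealM.
have cca : I ((1 - b) ^+ N * a).
  have [i [r [Ii <-]]] := Imax _ bN; rewrite mulrDr; apply: (idealD II).
    exact: idealM.
  by rewrite mulrCA [_ * b ^+ N]mulrC; apply: idealM.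
exfalso; apply: (Ia a) => //.
have gen k : forall x y, I (x ^+ k * a) -> forall l, I (y ^+ l * a) -> I ((x + y) ^+ (k + l) * a).
  move=> x y xk l yl; rewrite exprDn mulr_suml; apply: ideal_sum => // i _.
  rewrite -mulr_natl -!mulrA; apply: idealM => //.
  have [li|il] := leqP l i.
    by rewrite -(subnK li) exprD -mulrA; do 2!apply: idealM => //.
  have ki : (k <= k + l - i)%N by lia.
  rewrite -(subnK ki) exprD mulrCA -mulrA mulrCA; do 2!apply: idealM => //.
by have := gen N b (1 - b) bca N cca; rewrite addrC subrK expr1n mul1r.
Qed.

Section Truncated.
Variables (A : comNzRingType) (N : nat).
Local Notation P := ({poly A} : comPzRingType).

Lemma low_ideal : is_ideal [set p : P | forall i, (i < N)%N -> p`_i = 0].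
Proof.
split=> [i _|p q p0 q0 i iN|p q q0 i iN] /=; first by rewrite poly.coef0.
  by rewrite poly.coefD p0// q0// addr0.
rewrite poly.coefM big1// => j _; rewrite q0 ?mulr0//.
by apply: leq_ltn_trans iN; rewrite leq_subr.
Qed.

Lemma one_closed (s t : P) : [set 1] s -> [set 1] t -> [set (1 : P)] (s * t).
Proof. by move=> -> ->; rewrite /= mulr1. Qed.

(* A[X] / (X^N) *)
Definition trunc := loc (@LocData P [set 1] _ erefl one_closed low_ideal).
HB.instance Definition _ := GRing.ComPzRing.on trunc.

Definition tpoly : {rmorphism {poly A} -> trunc} := @loc_in P _.
Definition tconst : {rmorphism A -> trunc} := (tpoly \o @polyC A : {rmorphism A -> trunc}).
Definition tX : trunc := tpoly 'X.

Lemma tpoly_eq0 p : tpoly p = 0 <-> forall i, (i < N)%N -> p`_i = 0.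
Proof.
split=> [/loc_in_eq0[v [-> ]]|p0]; first by rewrite mul1r.
by apply/loc_in_eq0; exists 1; split=> //; rewrite mul1r.
Qed.

Lemma tpoly_surj x : exists p, x = tpoly p.
Proof.
by have [p [s [-> e]]] := loc_ex x; exists p; apply: etrans e; rewrite rmorph1 mulr1.
Qed.

Lemma tpoly_lift (T : comPzRingType) (f : {rmorphism {poly A} -> T}) :
  (forall p : {poly A}, (forall i, (i < N)%N -> p`_i = 0) -> f p = 0) ->
  exists F : {rmorphism trunc -> T}, forall p, F (tpoly p) = f p.
Proof.
move=> f0; apply: (@loc_lift P _ T f) => //= s ->.
by rewrite rmorph1; exists 1; rewrite mulr1.
Qed.

Lemma tXn_eq0 k : (N <= k)%N -> tX ^+ k = 0.
Proof.
move=> Nk; rewrite -rmorphXn; apply/tpoly_eq0 => i iN; rewrite coefXn.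
by case: eqP => // e; move: iN; rewrite e ltnNge Nk.
Qed.

Lemma tX_nil : nilpotent tX.
Proof. by exists N; apply: tXn_eq0. Qed.

End Truncated.

Lemma trunc_map (A B : comNzRingType) (g : {rmorphism A -> B}) N :
  exists G : {rmorphism trunc A N -> trunc B N},
  [/\ forall a, G (tconst _ N a) = tconst _ N (g a), G (tX A N) = tX B N &
      injective g -> injective G].
Proof.
have [p p0|G GE] := @tpoly_lift A N (trunc B N) (tpoly B N \o map_poly g).
  by apply/tpoly_eq0 => i iN; rewrite coef_map p0//= rmorph0.
exists G; split=> [a||gI].
- by rewrite GE /= map_polyC.
- by rewrite GE /= map_polyX.
move=> x y xy; apply: subr0_eq.
have : G (x - y) = 0 by rewrite rmorphB xy subrr.
have [p ->] := tpoly_surj (x - y); rewrite GE => /tpoly_eq0 p0.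
apply/tpoly_eq0 => i /p0; rewrite coef_map => /eqP.
by rewrite -(rmorph0 g) (inj_eq gI) => /eqP.
Qed.

Section Deformation.
Variable A : comNzRingType.
Local Notation P := ({poly A} : comPzRingType).

Definition deform_den : set P := [set s | s.[0] = 1 /\ @invertible A s.[1]].

Lemma deform_den1 : deform_den 1.
Proof. by split; rewrite hornerC//; exists 1; rewrite mulr1. Qed.

Lemma deform_denM s t : deform_den s -> deform_den t -> deform_den (s * t).
Proof.
move=> [s0 s1] [t0 t1]; split; rewrite hornerM ?s0 ?t0 ?mulr1//.
exact: invertible_mul.
Qed.

Lemma zero_ideal : is_ideal [set (0 : P)].
Proof. by split=> [|a b -> ->|a b ->] //=; rewrite ?addr0 ?mulr0. Qed.

(* The localization of A[X] at the polynomials s with s(0) = 1 and s(1) invertible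
   can be evaluated at X = 1, and embeds into the product of the A[X] / (X^N). *)
Lemma deformation_ring : exists (D : comPzRingType) (j : {rmorphism A -> D}) (mu : D)
    (ev : {rmorphism D -> A}) (red : forall N, {rmorphism D -> trunc A N}),
  [/\ forall a, ev (j a) = a, ev mu = 1,
      forall c : A, invertible c -> invertible (1 + mu * (j c - 1)),
      forall N, (forall a, red N (j a) = tconst _ N a) /\ red N mu = tX A N &
      forall x, (forall N, red N x = 0) -> x = 0].
Proof.
pose d := LocData deform_den1 deform_denM zero_ideal.
have [|p ->|ev evE] := @loc_lift P d A (horner_eval (1 : A)); [by move=> s []|by rewrite rmorph0|].
have redP N : exists F : {rmorphism loc d -> trunc A N}, forall p, F (loc_in d p) = tpoly _ N p.
  apply: loc_lift => [s [s0 _]|p ->]; last by rewrite rmorph0.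
  (* As s(0) = 1, X divides s - 1; so s is 1 plus a nilpotent modulo X^N. *)
  rewrite -(subrK 1 s) rmorphD rmorph1 addrC; apply: invertible1D.
  have /factor_theorem[q ->] : root (s - 1) 0 by rewrite /root hornerD s0 hornerN hornerC subrr.
  exists N; rewrite -rmorphXn; apply/tpoly_eq0 => i iN.
  by rewrite polyC0 subr0 exprMn coefMXn iN.
pose red N := projT1 (cid (redP N)).
have redE N p : red N (loc_in d p) = tpoly _ N p by rewrite /red; case: cid.
exists (loc d), (@loc_in P d \o @polyC A : {rmorphism A -> loc d}), (loc_in d 'X), ev, red.
split=> [a|||N|x x0] /=.
- by rewrite evE /= /horner_eval hornerC.
- by rewrite evE /= /horner_eval hornerX.
(* The polynomial 1 + X (c - 1) has value 1 at 0 and c at 1, so it is a denominator. *)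
- move=> c cinv; rewrite -(rmorph1 (@loc_in P d)) -rmorphB -rmorphM -rmorphD.
  apply: loc_in_den; split; first by rewrite !hornerE.
  by rewrite (_ : _.[1] = c)// !hornerE /=; ring.
- by split=> [a|]; rewrite redE.
have [p [s [[s0 [t st]] xs]]] := loc_ex x.
(* Coefficient [i] of the numerator is read off modulo X^(i+1). *)
have p0 : p = 0.
  apply/polyP => i; rewrite poly.coef0.
  suff /tpoly_eq0/(_ i (ltnSn i)) : tpoly A i.+1 p = 0 by [].
  by rewrite -redE -xs rmorphM x0 mul0r.
have [y sy] : invertible (loc_in d s) by apply: loc_in_den; split=> //; exists t.
by rewrite -[x]mulr1 -sy mulrA xs p0 rmorph0 mul0r.
Qed.

End Deformation.

(** * Comparison of regular functions by deformation *)

Lemma itmapZ (A B : comPzRingType) (g : {rmorphism A -> B}) n a (f : itlaurent A n) :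
  itmap g n (a *: f) = g a *: itmap g n f.
Proof. by apply: coef_inj => l; rewrite !(coef_itmap, coefZ) rmorphM. Qed.

Lemma itmap_comp (A B C : comPzRingType) (g : {rmorphism A -> B}) (h : {rmorphism B -> C})
    (k : {rmorphism A -> C}) n (f : itlaurent A n) :
  (forall a, h (g a) = k a) -> itmap h n (itmap g n f) = itmap k n f.
Proof. by move=> hgk; apply: coef_inj => l; rewrite !coef_itmap hgk. Qed.

Lemma itmap_id (A : comPzRingType) (g : {rmorphism A -> A}) n (f : itlaurent A n) :
  (forall a, g a = a) -> itmap g n f = f.
Proof. by move=> gid; apply: coef_inj => l; rewrite coef_itmap gid. Qed.

(** * Deformation for a functor with prescribed leading exponents, common to both statements *)

Section Core.
Variables (n m : nat) (kappa : {additive 'cV[int]_n -> 'cV[int]_m}).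
Variables (F : functor rings) (hom : forall A : comPzRingType, F A -> calgHom A n m).

Definition good (A : comPzRingType) (u : 'I_n -> itlaurent A m) :=
  forall i, lead (kappa (delta_mx i 0)) (u i).

Hypothesis F_graph : forall (A B : comPzRingType) (g : {rmorphism A -> B}) (x : F A) (y : F B),
  (forall i, hom y (tvar B i) = itmap g m (hom x (tvar A i))) -> @fgraph rings F A B g x y.
Hypothesis F_ex : forall (A : comPzRingType) (u : 'I_n -> itlaurent A m), good u ->
  exists x : F A, forall i, hom x (tvar A i) = u i.

Variables r s : regular_fun (prod_functor F (LGa n)).

(** Phrased for a tuple [u] and all points over it, so that base change acts on plain tuples of
    series. *)
Definition agree (A : comPzRingType) (u : 'I_n -> itlaurent A m) (f : itlaurent A n) :=
  forall x : F A, (forall i, hom x (tvar A i) = u i) -> r A (x, f) = s A (x, f).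

Lemma good_map (A B : comPzRingType) (g : {rmorphism A -> B}) (u : 'I_n -> itlaurent A m) :
  good u -> good (fun i => itmap g m (u i)).
Proof. by move=> gu i; apply: lead_map. Qed.

Lemma reg_map (A B : comPzRingType) (g : {rmorphism A -> B}) (f : itlaurent A n)
    (x : F A) (y : F B) (t : regular_fun (prod_functor F (LGa n))) :
  (forall i, hom y (tvar B i) = itmap g m (hom x (tvar A i))) ->
  t B (y, itmap g n f) = g (t A (x, f)).
Proof.
move=> xy; apply: (@reg_natural _ _ t A B g (x, f) (y, itmap g n f)).
by split=> //; apply: F_graph.
Qed.

(** [F_ex] provides a point over [u]; every point over the mapped tuple is a base change of it, and
    naturality compares the values. *)
Lemma agree_map (A B : comPzRingType) (g : {rmorphism A -> B})
    (u : 'I_n -> itlaurent A m) (f : itlaurent A n) :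
  good u -> agree u f -> agree (fun i => itmap g m (u i)) (itmap g n f).
Proof.
move=> /F_ex[x xu] agr y yu.
by rewrite !(@reg_map _ _ g f x y) ?agr// => i; rewrite yu xu.
Qed.

Lemma agree_inj (A : comPzRingType) (I : Type) (B : I -> comPzRingType)
    (g : forall k, {rmorphism A -> B k}) (u : 'I_n -> itlaurent A m) (f : itlaurent A n) :
  (forall a, (forall k, g k a = 0) -> a = 0) -> good u ->
  (forall k, agree (fun i => itmap (g k) m (u i)) (itmap (g k) n f)) -> agree u f.
Proof.
move=> ginj gu agr x xu; apply: subr0_eq; apply: ginj => k.
have [y yu] := F_ex (good_map (g k) gu).
rewrite rmorphB -!(@reg_map _ _ (g k) f x y); try by move=> i; rewrite yu xu.
by rewrite agr ?subrr.
Qed.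

Lemma agree_deform :
  (forall (A : comNzRingType) N (h : 'I_n -> itlaurent A m) (f : itlaurent A n),
    agree (fun i => mono (trunc A N) (kappa (delta_mx i 0)) +
                    tX A N *: itmap (tconst A N) m (h i)) (itmap (tconst A N) n f)) ->
  forall (A : comPzRingType) (u : 'I_n -> itlaurent A m) (f : itlaurent A n),
  good u -> agree u f.
Proof.
move=> agrN A u f gu.
have [A0|] := eqVneq (1 : A) 0.
  by move=> x _; rewrite -[r _ _]mul1r -[s _ _]mul1r A0 !mul0r.
move=> /nz_ring[A' eA]; case: _ / eA in u f gu *; move: A' => {}A in u f gu *.
have [D [j [mu [ev [red [evj evmu muinv redE redinj]]]]]] := deformation_ring A.
pose h i := u i - mono A (kappa (delta_mx i 0)).
pose U i := mono D (kappa (delta_mx i 0)) + mu *: itmap j m (h i).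
have gU : good U.
  move=> i; rewrite /U /h rmorphB /= itmap_mono; apply: lead_deform; first exact: lead_map.
  by rewrite coef_itmap; apply: muinv; have [_] := lead_coef (gu i).
have agrU : agree U (itmap j n f).
  apply: (agree_inj redinj gU) => N.
  have [redj redmu] := redE N.
  have := agrN A N h f.
  rewrite (itmap_comp _ redj); congr agree; apply/funext => i.
  by rewrite /U [RHS]rmorphD /= itmap_mono itmapZ redmu (itmap_comp _ redj).
have := @agree_map _ _ ev _ _ gU agrU.
rewrite (@itmap_comp _ _ _ j ev idfun) ?itmap_id//; congr agree.
apply/funext => i; rewrite /U rmorphD /= itmap_mono itmapZ evmu scale1r.
by rewrite (@itmap_comp _ _ _ j ev idfun)// itmap_id// /h addrC subrK.
Qed.

End Core.

Lemma finite_weight n (N : nat) :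
  finite_set [set l : 'cV[int]_n | (\sum_i absz (l i 0%R) < N)%N].
Proof.
have Eb : bnd [set l : 'cV[int]_n | forall i, - N%:Z <= l i 0 <= N%:Z].
  elim: n => [|n IHn]; first by exists tt.
  apply/bndS; split=> [|j]; first by exists (- N%:Z) => l /(_ ord_max)/andP[].
  by apply: bndW IHn => l lN i; have := lN (lift ord_max i); rewrite mxE liftK.
apply: sub_finite_set (bnd_fin Eb Eb) => l lN.
have lNi i : (absz (l i 0%R) < N)%N.
  by apply: leq_ltn_trans lN; rewrite (bigD1 i)//= leq_addr.
by split=> i; have := lNi i; rewrite ?mxE; move: (l i 0) => a; lia.
Qed.

(** * Torsion-free covers *)

Section Cover.
Import monalg.
Variable A : comNzRingType.
Local Notation K := {cmonom A}.

(** Evaluation of monomials in variables indexed by the elements of [A], each variable going to the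
    element that indexes it. *)
Definition cmval (k : K) : A := \prod_(a <- finsupp k) a ^+ (k a).

Lemma cmvalEw (d : {fset A}) (k : K) : fsubset (finsupp k) d ->
  cmval k = \prod_(a <- d) a ^+ (k a).
Proof.
move=> le; rewrite /cmval (big_fset_incl _ le)// => a _.
by rewrite -cmE_neq0 negbK => /eqP ->.
Qed.

Lemma cmval_mmorphism : mmorphism cmval.
Proof.
split=> [k l|]; last by rewrite /cmval mdom1 big_seq_fset0.
rewrite {1}/cmval mdomD (cmvalEw (fsubsetUl _ (finsupp l))).
rewrite (cmvalEw (fsubsetUr (finsupp k) _)) -big_split /=.
by apply: eq_bigr => a _; rewrite cmM exprD.
Qed.

HB.instance Definition _ := isMultiplicative.Build K A cmval cmval_mmorphism.

Lemma cmvalU a : cmval (ucm a) = a.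
Proof. by rewrite /cmval mdomU big_seq_fset1 cmUU expr1. Qed.

Definition ucmU (k : K) : {malg rat[K]} := mkmalgU k 1.

Lemma ucmU_mmorphism : mmorphism ucmU.
Proof.
split=> [k l|//]; rewrite /ucmU malgM_def fgmulUU mulr1 //.
Qed.

HB.instance Definition _ := isMultiplicative.Build K {malg rat[K]} ucmU ucmU_mmorphism.

Definition ratC : {rmorphism int -> {malg rat[K]}} :=
  @mkmalgU K rat mone \o (intmul 1 : {rmorphism int -> rat}).

(** [B] is the polynomial ring over the integers with one variable for each element of [A], and [BQ]
    is its analogue over [rat]. The map between them is the inclusion of coefficients. *)
Lemma torsion_free_cover : exists (B BQ : comNzRingType) (g : {rmorphism B -> A})
    (i : {rmorphism B -> BQ}) (q : {rmorphism rat -> BQ}),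
  (forall a, exists b, g b = a) /\ injective i.
Proof.
exists {malg int[K]}, {malg rat[K]}, (mmap (intmul 1) cmval), (mmap ratC ucmU), (@mkmalgU K rat mone).
split=> [a|]; first by exists (mkmalgU (ucm a) 1); rewrite /= mmapU cmvalU mul1r.
have coefE (p : {malg int[K]}) k : mcoeff k (mmap ratC ucmU p) = (mcoeff k p)%:~R.
  rewrite mmapE raddf_sum /=.
  under eq_bigr => l _ do rewrite mul_malgC mcoeffZ mcoeffU.
  case: (msuppP p k) => kp.
    rewrite (big_fsetD1 k)//= eqxx mulr1 big1_seq ?addr0// => l.
    by rewrite in_fsetD1 => /andP[_ /andP[/negPf -> _]]; rewrite mulr0.
  rewrite big1_seq ?mulr0z// => l /andP[_ lp].
  by case: eqP lp kp => [-> ->//|]; rewrite mulr0.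
move=> p p' e; apply/malgP => k; apply: (@intr_inj rat).
by rewrite -!coefE e.
Qed.

End Cover.

(** * Restriction to Q-algebras *)

Lemma additive_pack (U V : zmodType) (f : U -> V) : zmod_morphism f ->
  exists g : {additive U -> V}, g =1 f.
Proof.
move=> fB; pose a := GRing.isZmodMorphism.Build U V f fB.
by exists (HB.pack_for {additive U -> V} f a).
Qed.

Lemma itmap_surj (A B : comPzRingType) (g : {rmorphism B -> A}) n :
  (forall a, exists b, g b = a) -> forall f : itlaurent A n, exists f', itmap g n f' = f.
Proof.
move=> /choice[sigma gs] f.
(* Coefficients equal to 0 are lifted to 0, since [sigma 0] may be nonzero and the support has to
   stay bounded. *)
have [|f' f'E] := @ofcoef B n (fun l => if coef f l == 0 then 0 else sigma (coef f l)).
  by apply: bndW (supp_bnd f) => l; rewrite /supp /=; case: eqP.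
exists f'; apply: coef_inj => l; rewrite coef_itmap f'E.
by case: eqP => [->|_]; rewrite ?rmorph0 ?gs.
Qed.

Lemma mono_unit (A : comPzRingType) n (l : 'cV[int]_n) : mono A l * mono A (- l) = 1.
Proof. by rewrite -monoD subrr mono0. Qed.

(* kappa l is the valuation of phi(t^l) over B. *)
Lemma hom_leads (A B : comPzRingType) (g : {rmorphism A -> B}) n m (phi : calgHom A n m) :
  connected_ring B -> (1 : B) != 0 ->
  exists kappa : {additive 'cV[int]_n -> 'cV[int]_m}, proper_exponents kappa /\
    forall l, lead (kappa l) (itmap g m (phi (mono A l))).
Proof.
move=> Bc B0; pose Y l := itmap g m (phi (mono A l)).
have YD l l' : Y (l + l') = Y l * Y l' by rewrite /Y monoD !rmorphM.
have /choice[k0 k0P] : forall l, exists k, lead k (Y l).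
  move=> l; apply: (lead_unit (g := Y (- l)) Bc).
  by rewrite /Y -!rmorphM mono_unit !rmorph1.
have k0D l l' : k0 (l + l') = k0 l + k0 l'.
  by apply: (lead_unique B0 (k0P _)); rewrite YD; apply: leadM.
have [|kappa kE] := @additive_pack _ _ k0.
  by move=> l l'; apply: (@addIr _ (k0 l')); rewrite -k0D !subrK.
have kP l : lead (kappa l) (Y l) by rewrite kE.
exists kappa; split=> // F Fb.
(* The coefficient of phi(t^(-l)) at [- kappa l] maps to a leading coefficient over [B], which is
   nonzero; so continuity of [phi] gives properness. *)
apply: bndW (calgHom_summable phi Fb) => l Fl; exists (kappa l) => //.
rewrite -raddfN => phi0; apply: (lead_coef_neq0 B0 (kP (- l))).
by rewrite /Y coef_itmap phi0 rmorph0.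
Qed.

Lemma regular_Q_inj n m :
  injective
    (@regular_Q (prod_functor (Homcalg n m) (LGa n)) :
       regular_fun (prod_functor (Homcalg n m) (LGa n)) ->
       regular_fun (prod_functor (restrict_Q (Homcalg n m)) (restrict_Q (LGa n)))).
Proof.
move=> r s rs.
have rsQ (Q : Qalgebra) x : r (Qring Q) x = s (Qring Q) x.
  exact: (congr1 (fun t : regular_fun (restrict_Q _) => t Q x) rs).
apply: regularP => A [phi f]; apply: contrapT => /eqP; rewrite -subr_eq0.
move=> /connected_quotient[B [g [ga Bc]]].
have B0 : (1 : B) != 0.
  by apply: contra_neq ga => B1; rewrite -[LHS]mul1r B1 mul0r.
have [kappa [kP kL]] := hom_leads g phi Bc B0.
pose hom (C : comPzRingType) (x : Homcalg n m C) : calgHom C n m := x.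
have F_graph (C D : comPzRingType) (h : {rmorphism C -> D}) (x : Homcalg n m C) (y : Homcalg n m D) :
  (forall i, hom D y (tvar D i) = itmap h m (hom C x (tvar C i))) ->
  @fgraph rings (Homcalg n m) C D h x y by [].
have F_ex (C : comPzRingType) (u : 'I_n -> itlaurent C m) : good kappa u ->
    exists x : Homcalg n m C, forall i, hom C x (tvar C i) = u i.
  exact: hom_of_leads.
pose u i := itmap g m (phi (tvar A i)).
have gu : good kappa u by move=> i; rewrite /u tvar_mono; apply: kL.
have [psi psiu] := F_ex B u gu.
case/eqP: ga; rewrite rmorphB -!(@reg_map _ _ _ hom F_graph _ _ g f phi psi)//.
apply/eqP; rewrite subr_eq0; apply/eqP.
apply: (@agree_deform _ _ _ _ hom F_graph F_ex r s _ B u _ gu psi psiu).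
move=> C N h k.
have [D [DQ [p [i [q [psurj iinj]]]]]] := torsion_free_cover C.
have [P [Pc PX _]] := trunc_map p N.
have [I [Ic IX Iinj]] := trunc_map i N.
have /choice[h' h'E] := fun i => itmap_surj psurj (h i).
have [k' k'E] := itmap_surj psurj k.
(* The perturbation is a multiple of the nilpotent [tX], so any lift of its coefficients keeps the
   leading exponents. *)
pose U j := mono (trunc D N) (kappa (delta_mx j 0)) + tX D N *: itmap (tconst D N) m (h' j).
have gU : good kappa U.
  move=> j; apply: lead_nilD; first exact: lead_mono.
  by apply: nilMr; apply: nil_map; apply: tX_nil.
have agrU : agree hom r s U (itmap (tconst D N) n k').
  apply: (@agree_inj _ _ _ _ hom F_graph F_ex r s _ unit (fun=> trunc DQ N) (fun=> I)) => //.
    by move=> a /(_ tt) Ia; apply: (Iinj iinj); rewrite Ia rmorph0.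
  move=> _ x xu.
  (* [trunc DQ N] is a Q-algebra, so the hypothesis applies to each of its points. *)
  pose Q := @QAlgebra (trunc DQ N) (tconst DQ N \o q : {rmorphism rat -> trunc DQ N}).
  exact: (rsQ Q).
have := @agree_map _ _ _ _ hom F_graph F_ex r s _ _ P _ _ gU agrU.
have Pc' a : P (tconst D N a) = (tconst C N \o p) a by rewrite Pc.
rewrite (@itmap_comp _ _ _ _ P _ _ _ Pc') -(@itmap_comp _ _ _ p (tconst C N))// k'E.
congr (agree _ _ _ _ _); apply/funext => j.
rewrite /U rmorphD /= itmap_mono itmapZ PX (@itmap_comp _ _ _ _ P _ _ _ Pc').
by rewrite -(@itmap_comp _ _ _ p (tconst C N))// h'E.
Qed.

(** * Restriction to nilpotent Laurent polynomials *)

(** A single leading exponent holds over all of [A], so the decomposition with one factor witnesses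
    the valuation. *)
Lemma lead_KerUpsilon (A : comPzRingType) n (phi : calgHom A n n) :
  (forall i, lead (delta_mx i 0) (phi (tvar A i))) -> KerUpsilon phi.
Proof.
move=> phil; rewrite /KerUpsilon; apply/matrixP => i j; rewrite mxE.
have [lt_nil inv] := lead_coef (phil j).
rewrite (@nuE _ _ _ (delta_mx j 0)); first by rewrite !mxE eqxx andbT.
exists 1%N, (fun=> A), (fun=> idfun), (fun=> delta_mx j 0); split.
  move=> y; exists (y 0); split=> [i'|x /(_ 0)/= <-]//; by rewrite (ord1 i').
move=> _; split; rewrite ?coef_itmap//.
- by move=> l' l'j; rewrite coef_itmap; apply: lt_nil.
- by move=> q; apply/colP => k; rewrite !mxE; case: eqP.
Qed.

Lemma prime_exists (A : comPzRingType) : (1 : A) != 0 -> exists q : spec A, True.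
Proof.
move=> /eqP A0; apply: contrapT => noq; apply: A0.
have [|k] := @nil_primeP A 1; last by rewrite expr1n.
by move=> p pP; case: noq; exists (Spec pP).
Qed.

(** Over the connected ring [B] there is a single leading exponent, so it can be compared with the
    valuation over [A] at one prime of [B]. *)
Lemma KerUpsilon_lead (A B : comPzRingType) (g : {rmorphism A -> B}) n (phi : calgHom A n n) :
  connected_ring B -> (1 : B) != 0 -> KerUpsilon phi ->
  forall i, lead (delta_mx i 0) (itmap g n (phi (tvar A i))).
Proof.
move=> Bc B0 phiK i; have [q _] := prime_exists B0; pose p := spec_map g q.
have qP := specP q.
pose t := phi (tvar A i).
have [l tl] : exists l, lead l (itmap g n t).
  apply: (lead_unit (g := itmap g n (phi (mono A (- delta_mx i 0)))) Bc).
  by rewrite /t tvar_mono -!rmorphM mono_unit !rmorph1.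
have nuE' j : nu t j 0 = (j == i)%:R.
  by have /matrixP/(_ j i) := phiK; rewrite !mxE.
(* Without a valuation [nu t] would be the dummy value 0, against the diagonal entry 1. *)
have tv : has_valuation t (nu t).
  have [ex|/forallNP nex] := pselect (exists v, has_valuation t v).
    exact: xgetPex.
  have nu0 : nu t = 0 by apply: xgetPN.
  have := congr1 (fun z : underZ A => z p) (nuE' i).
  by rewrite nu0 mxE eqxx.
have := has_valuation_spec p tv.
rewrite (_ : map_mx _ _ = delta_mx i 0); last first.
  by apply/colP => j; rewrite !mxE nuE' eqxx andbT; case: eqP.
move=> [pe plt]; suff <- : l = delta_mx i 0 by [].
have [tlt tinv] := lead_coef tl; rewrite coef_itmap in tinv.
apply: contrapT => /eqP le.
have /orP[lel|lel] := lexle_total l (delta_mx i 0).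
  by apply: (invertible_notin tinv (q := q)); apply: plt; rewrite /lexlt lel.
apply: pe; apply: (nilpotent_in (g := g)); rewrite -coef_itmap; apply: tlt.
by rewrite /lexlt lel eq_sym.
Qed.

Section KernelOfUpsilon.
Variable n : nat.
Local Notation F := (KerUpsilon_functor n).

Definition ker_hom (A : comPzRingType) (x : F A) : calgHom A n n := sval x.

(** The map [kappa] for the kernel of [Upsilon]: the image of t_i has the leading exponent of
    t_i. *)
Definition idlat : {additive 'cV[int]_n -> 'cV[int]_n} := idfun.

Lemma ker_graph (A B : comPzRingType) (g : {rmorphism A -> B}) (x : F A) (y : F B) :
  (forall i, ker_hom y (tvar B i) = itmap g n (ker_hom x (tvar A i))) ->
  @fgraph rings F A B g x y.
Proof. by []. Qed.

Lemma ker_ex (A : comPzRingType) (u : 'I_n -> itlaurent A n) : good idlat u ->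
  exists x : F A, forall i, ker_hom x (tvar A i) = u i.
Proof.
move=> gu; have [|phi phiu] := @hom_of_leads A n n idlat u _ gu; first by move=> E.
have K : KerUpsilon phi by apply: lead_KerUpsilon => i; rewrite phiu; apply: gu.
by exists (exist _ phi K).
Qed.

Variables r s : regular_fun (prod_functor F (LGa n)).
Hypothesis rs : pullback (prod_map (KerUpsilon_nil_incl n) (id_map (LGa n))) r =
  pullback (prod_map (KerUpsilon_nil_incl n) (id_map (LGa n))) s.

Lemma agree_nil (A : comPzRingType) (u : 'I_n -> itlaurent A n) (f : itlaurent A n) :
  (forall i, exists h : itlaurent A n, [/\ u i = tvar A i + h, finite_set (supp h) &
        forall l, nilpotent (coef h l)]) -> agree ker_hom r s u f.
Proof.
move=> unil [phi phiK] /= phiu.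
have phin : KerUpsilon_nil phi by move=> i; rewrite phiu.
have := congr1 (fun t : regular_fun (prod_functor (KerUpsilon_nil_functor n) (LGa n)) => t A (exist _ phi phin, f)) rs.
rewrite /= (_ : exist _ phi _ = exist _ phi phiK)//.
by congr exist; apply: Prop_irrelevance.
Qed.

(* The coefficient of t^l in the nilpotent part of u is multiplied by mu^(|l|), so
   that only finitely many of these coefficients survive modulo a power of mu. *)
Lemma agree_nil_scalar (A : comPzRingType) (c : A) (h : 'I_n -> itlaurent A n)
    (f : itlaurent A n) : nilpotent c ->
  agree ker_hom r s (fun i => mono A (delta_mx i 0) + c *: h i) f.
Proof.
move=> cn; have [A0|] := eqVneq (1 : A) 0.
  by move=> x _; rewrite -[r _ _]mul1r -[s _ _]mul1r A0 !mul0r.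
move=> /nz_ring[A' eA]; case: _ / eA in c h f cn *; move: A' => {}A in c h f cn *.
(* Here [mu] is the parameter of the second deformation. The first one is represented by the
   nilpotent [c], which makes the tuple [U] good. *)
have [D [j [mu [ev [red [evj evmu _ redE redinj]]]]]] := deformation_ring A.
pose w (l : 'cV[int]_n) := (\sum_i absz (l i 0%R))%N.
have /choice[H HE] : forall i, exists H : itlaurent D n,
    forall l, coef H l = j (coef (h i) l) * mu ^+ w l.
  move=> i; apply: ofcoef; apply: bndW (supp_bnd (h i)) => l.
  by move=> /mul_neq0[jl _]; apply: contra_neqN jl => /eqP ->; rewrite rmorph0.
pose U i := mono D (delta_mx i 0) + j c *: H i.
have gU : good idlat U.
  move=> i; apply: lead_nilD; first exact: lead_mono.
  by apply: nilMr; apply/nil_map/nil_map.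
have agrU : agree ker_hom r s U (itmap j n f).
  apply: (@agree_inj _ _ _ _ _ ker_graph ker_ex r s _ _ _ red _ _ redinj gU) => N.
  have [redj redmu] := redE N.
  apply: agree_nil => i; exists (tconst A N c *: itmap (red N) n (H i)); split.
  - by rewrite /U rmorphD /= itmap_mono itmapZ redj tvar_mono.
  - apply: sub_finite_set (finite_weight n N) => l; rewrite /supp /= coefZ coef_itmap HE.
    apply: contraNT; rewrite -leqNgt => Nw.
    by rewrite rmorphM rmorphXn redmu tXn_eq0// !mulr0.
  - by move=> l; rewrite coefZ; apply/nilMr/nil_map.
have := @agree_map _ _ _ _ _ ker_graph ker_ex r s _ _ ev _ _ gU agrU.
rewrite (@itmap_comp _ _ _ j ev idfun) ?itmap_id//; congr (agree _ _ _ _ _).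
apply/funext => i; rewrite /U rmorphD /= itmap_mono itmapZ evj; congr (_ + _ *: _).
by apply: coef_inj => l; rewrite coef_itmap HE rmorphM rmorphXn evmu expr1n mulr1 evj.
Qed.

Lemma agree_ker (A : comPzRingType) (u : 'I_n -> itlaurent A n) (f : itlaurent A n) :
  good idlat u -> agree ker_hom r s u f.
Proof.
apply: (agree_deform ker_graph ker_ex) => B N h k.
by apply: agree_nil_scalar; apply: tX_nil.
Qed.

End KernelOfUpsilon.

Lemma pullback_nil_inj n :
  injective
    (pullback (prod_map (KerUpsilon_nil_incl n) (id_map (LGa n))) :
       regular_fun (prod_functor (KerUpsilon_functor n) (LGa n)) ->
       regular_fun (prod_functor (KerUpsilon_nil_functor n) (LGa n))).
Proof.
move=> r s rs; apply: regularP => A [phi f]; apply: contrapT => /eqP; rewrite -subr_eq0.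
move=> /connected_quotient[B [g [ga Bc]]].
have B0 : (1 : B) != 0.
  by apply: contra_neq ga => B1; rewrite -[LHS]mul1r B1 mul0r.
pose u i := itmap g n (ker_hom phi (tvar A i)).
have gu : good (idlat n) u by move=> i; apply: KerUpsilon_lead => //; case: phi {ga u}.
have [psi psiu] := ker_ex gu.
case/eqP: ga; rewrite rmorphB -!(@reg_map _ _ _ _ (@ker_graph n) _ _ g f phi psi)//.
by apply/eqP; rewrite subr_eq0; apply/eqP; apply: (agree_ker rs (itmap g n f) gu psiu).
Qed.

Theorem corollary5p2 (m n : nat) (hm : (1 <= m)%N) (hn : (1 <= n)%N) :
  injective
    (@regular_Q (prod_functor (Homcalg n m) (LGa n)) :
       regular_fun (prod_functor (Homcalg n m) (LGa n)) ->
       regular_fun (prod_functor (restrict_Q (Homcalg n m)) (restrict_Q (LGa n)))) /\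
  injective
    (pullback (prod_map (KerUpsilon_nil_incl n) (id_map (LGa n))) :
       regular_fun (prod_functor (KerUpsilon_functor n) (LGa n)) ->
       regular_fun (prod_functor (KerUpsilon_nil_functor n) (LGa n))).
Proof. by split; [apply: regular_Q_inj|apply: pullback_nil_inj]. Qed.
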